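(* Let $(A,\rho,[\cdot,\cdot])$ be a skew algebroid, $\Omega\in\Gamma(\wedge^2A^\star)$ a nondegenerate $2$-form on $A$, $\theta\in\Gamma(A^\star)$, and let $(\Pi,\xi)$ be the contravariant pair associated with $(\Omega,\theta)$, i.e. $\Pi(\alpha,\beta)=\Omega(\sharp_\Omega(\alpha),\sharp_\Omega(\beta))$ and $\xi=\sharp_\Omega(\theta)$. Then $(\Omega,\theta)$ is a locally conformally symplectic structure if and only if $(\Pi,\xi)$ is a Jacobi structure.
   Context: A skew algebroid on a smooth manifold $M$ is a vector bundle $A\to M$ with a vector bundle morphism $\rho:A\to TM$ (the anchor) and a skew-symmetric $\mathbb{R}$-bilinear bracket on $\Gamma(A)$ satisfying $[a,\varphi b]=\varphi[a,b]+(\rho(a)\cdot\varphi)b$. Exterior differential: $d_\rho\varphi(a)=\rho(a)\cdot\varphi$ and, for $\eta\in\Gamma(\wedge^kA^\star)$, $d_\rho\eta(a_0,\dots,a_k)=\sum_i(-1)^i\rho(a_i)\cdot\eta(a_0,\dots,\widehat{a_i},\dots,a_k)+\sum_{i<j}(-1)^{i+j}\eta([a_i,a_j],a_0,\dots,\widehat{a_i},\dots,\widehat{a_j},\dots,a_k)$. Lie derivative: $\mathcal{L}^\rho_a\varphi=\rho(a)\cdot\varphi$, $(\mathcal{L}^\rho_a\eta)(a_1,\dots,a_k)=\rho(a)\cdot\eta(a_1,\dots,a_k)-\sum_i\eta(a_1,\dots,[a,a_i],\dots,a_k)$, and $\langle\mathcal{L}^\rho_aP,\eta\rangle=\rho(a)\cdot\langle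 P,\eta\rangle-\langle P,\mathcal{L}^\rho_a\eta\rangle$ for multivector fields $P$. The Schouten–Nijenhuis bracket on $\Gamma(\wedge^\bullet A)$ is the unique $\mathbb{R}$-bilinear bracket with $[\varphi,\psi]=0$ for functions, $[a,P]=\mathcal{L}^\rho_aP$ for $a\in\Gamma(A)$, $[P,Q]=(-1)^{kl}[Q,P]$ and $[P,Q\wedge R]=[P,Q]\wedge R+(-1)^{(k+1)l}Q\wedge[P,R]$ for $P\in\Gamma(\wedge^kA)$, $Q\in\Gamma(\wedge^lA)$. Exterior products are normalised so that $(\xi\wedge\Pi)(\alpha,\beta,\gamma)=\alpha(\xi)\Pi(\beta,\gamma)+\beta(\xi)\Pi(\gamma,\alpha)+\gamma(\xi)\Pi(\alpha,\beta)$, and similarly for forms. A pair $(\Pi,\xi)$ with $\Pi\in\Gamma(\wedge^2A)$, $\xi\in\Gamma(A)$ is a Jacobi structure if $[\Pi,\Pi]=2\xi\wedge\Pi$ and $\mathcal{L}^\rho_\xi\Pi=0$. $\sharp_\Omega$ is the inverse of the isomorphism $\flat_\Omega:A\to A^\star$, $\flat_\Omega(a)=-i_a\Omega=-\Omega(a,\cdot)$. The pair $(\Omega,\theta)$ (with $\Omega$ nondegenerate) is a locally conformally symplectic structure if $d_\rho\theta=0$ and $d_\rho\Omega+\theta\wedge\Omega=0$. *)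

(* Defs.v *)
From HB Require Import structures.
From mathcomp Require Import all_boot all_order all_algebra.
From mathcomp Require Import all_classical all_reals topology normedtype derive.

Set Implicit Arguments.
Unset Strict Implicit.
Unset Printing Implicit Defensive.

Import Order.TTheory GRing.Theory Num.Theory.
Import numFieldNormedType.Exports.
Local Open Scope classical_set_scope.
Local Open Scope ring_scope.

(* Throughout, functions, sections and tensor fields are plain (dependent)
   functions on the manifold, together with a smoothness predicate; operations
   such as the anchor or the brackets are specified on smooth arguments, and
   their values on non-smooth ones are irrelevant. *)

(** * Smooth manifolds *)

Fixpoint Ck (R : realType) (n k : nat) (V : set 'rV[R]_n) (f : 'rV[R]_n -> R)
    : Prop :=
  match k with
  | 0 => forall v, V v -> {for v, continuous f}
  | k'.+1 => (forall v, V v -> differentiable f v) /\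
             (forall i : 'I_n, Ck k' V ('D_(delta_mx 0 i) f))
  end.

Definition Cinfty (R : realType) (n : nat) (V : set 'rV[R]_n)
    (f : 'rV[R]_n -> R) : Prop := forall k, Ck k V f.

(* A smooth atlas, not required to be maximal. *)
Record manifold (R : realType) (n : nat) := Manifold {
  carrier :> topologicalType;
  manifold_hausdorff : hausdorff_space carrier;
  manifold_second_countable : @second_countable carrier;
  chart : Type;
  chart_dom : chart -> set carrier;
  chart_map : chart -> carrier -> 'rV[R]_n;
  chart_inv : chart -> 'rV[R]_n -> carrier;
  chart_cover : forall x, exists c, chart_dom c x;
  chart_dom_open : forall c, open (chart_dom c);
  chart_codom_open : forall c, open (chart_map c @` chart_dom c);
  chart_mapK : forall c x, chart_dom c x -> chart_inv c (chart_map c x) = x;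
  chart_map_continuous : forall c,
    {within chart_dom c, continuous (chart_map c)};
  chart_inv_continuous : forall c,
    {within chart_map c @` chart_dom c, continuous (chart_inv c)};
  chart_transition : forall c d (i : 'I_n),
    Cinfty (chart_map c @` (chart_dom c `&` chart_dom d))
           (fun v => chart_map d (chart_inv c v) 0 i)
}.

Definition smooth_on (R : realType) (n : nat) (M : manifold R n) (U : set M)
    (f : M -> R) : Prop :=
  forall c : chart M,
    Cinfty (chart_map c @` (chart_dom c `&` U)) (f \o @chart_inv _ _ M c).

Definition smooth (R : realType) (n : nat) (M : manifold R n) (f : M -> R) :=
  smooth_on setT f.

(* T_x M, as the space of derivations of C^oo(M) at x; a derivation is extended
   by 0 to the functions which are not smooth. *)
Definition tangent (R : realType) (n : nat) (M : manifold R n) (x : M)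
    (D : (M -> R) -> R) : Prop :=
  [/\ forall (k : R) (f g : M -> R), smooth f -> smooth g ->
        D (fun y => k * f y + g y) = k * D f + D g,
      forall f g : M -> R, smooth f -> smooth g ->
        D (fun y => f y * g y) = D f * g x + f x * D g
    & forall f : M -> R, ~ smooth f -> D f = 0].

(** * Vector bundles *)

(* The smooth structure of the total space is the one for which the local
   trivializations are diffeomorphisms. *)
Record vbundle (R : realType) (n : nat) (M : manifold R n) (r : nat) := VBundle {
  fiber :> M -> vectType R;
  triv : Type;
  triv_dom : triv -> set M;
  triv_map : triv -> forall x, 'Hom(fiber x, 'rV[R]_r);
  triv_cover : forall x, exists t, triv_dom t x;
  triv_dom_open : forall t, open (triv_dom t);
  triv_bij : forall t x, triv_dom t x -> bijective (triv_map t x);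
  triv_transition : forall t u (i j : 'I_r),
    smooth_on (triv_dom t `&` triv_dom u)
      (fun x => triv_map u x ((triv_map t x)^-1%VF (delta_mx 0 i)) 0 j)
}.

Section Bundle.
Context {R : realType} {n : nat} {M : manifold R n} {r : nat}.
Variable A : vbundle M r.

Definition cofiber (x : M) : vectType R := 'Hom(A x, R^o).

Definition frame (t : triv A) (i : 'I_r) (x : M) : A x :=
  (triv_map t x)^-1%VF (delta_mx 0 i).

Definition coframe (t : triv A) (i : 'I_r) (x : M) : cofiber x :=
  linfun (fun v => triv_map t x v 0 i : R^o).

Definition section := forall x, A x.

Definition smooth_section (a : section) : Prop :=
  forall (t : triv A) (i : 'I_r),
    smooth_on (triv_dom t) (fun x => coframe t i x (a x)).

End Bundle.

(** * Exterior algebra *)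

(* An element of the full exterior algebra of V^* is a multilinear alternating
   function of lists of vectors of V; it has degree k if it vanishes on the
   lists of size different from k.  With V := A_x this gives the fibre of
   /\A^*; with V := A_x^* it gives that of /\A, where
   (a_1 /\ ... /\ a_k)(alpha_1, ..., alpha_k) = det (alpha_i(a_j)). *)
Section Exterior.
Context {R : realType} {V : vectType R}.
Implicit Types (P Q : seq V -> R) (s : seq V).

Definition multilinear P : Prop :=
  forall s1 s2 (k : R) (u v : V),
    P (s1 ++ (k *: u + v) :: s2) = k * P (s1 ++ u :: s2) + P (s1 ++ v :: s2).

Definition alternating P : Prop :=
  forall s1 s2 s3 (u : V), P (s1 ++ u :: s2 ++ u :: s3) = 0.

Definition homogeneous (k : nat) P : Prop := forall s, size s != k -> P s = 0.

Definition deg0 (c : R) s : R := if s is [::] then c else 0.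

Definition deg1 (f : V -> R) s : R := if s is [:: v] then f v else 0.

Definition inversions (m : bitseq) : nat :=
  (\sum_(i < size m | ~~ nth false m i) count id (drop i m))%N.

(* The sum runs over all shuffles: m marks the arguments given to P. *)
Definition ext_wedge P Q s : R :=
  \sum_(m : (size s).-tuple bool)
    (-1) ^+ inversions m * P (mask m s) * Q (mask (map negb m) s).

End Exterior.

Section Fields.
Context {R : realType} {n : nat} {M : manifold R n} {r : nat}.
Variable A : vbundle M r.

Definition form_field := forall x, seq (A x) -> R.

Definition mv_field := forall x, seq (cofiber A x) -> R.

Definition smooth_form (eta : form_field) : Prop :=
  (forall x, multilinear (eta x) /\ alternating (eta x)) /\
  forall (t : triv A) (I : seq 'I_r),
    smooth_on (triv_dom t) (fun x => eta x [seq frame t i x | i <- I]).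

Definition smooth_mvector (P : mv_field) : Prop :=
  (forall x, multilinear (P x) /\ alternating (P x)) /\
  forall (t : triv A) (I : seq 'I_r),
    smooth_on (triv_dom t) (fun x => P x [seq coframe t i x | i <- I]).

Definition form_degree (k : nat) (eta : form_field) : Prop :=
  forall x, homogeneous k (eta x).

Definition mv_degree (k : nat) (P : mv_field) : Prop :=
  forall x, homogeneous k (P x).

Definition mv_of_fun (f : M -> R) : mv_field := fun x => deg0 (f x).

Definition mv_of_section (a : section A) : mv_field :=
  fun x => deg1 (fun alpha : cofiber A x => alpha (a x)).

Definition eval_form (eta : form_field) (s : seq (section A)) : M -> R :=
  fun x => eta x [seq a x | a : section A <- s].

(* The duality pairing of /\A_x with /\A_x^*: the dual of a basis e_I of
   /\A_x is the basis e^I of /\A_x^*. *)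
Definition pairing (P : mv_field) (eta : form_field) (x : M) : R :=
  let e := vbasis {:A x} in
  \sum_(I : {set 'I_(\dim {:A x})})
    P x [seq linfun (coord e i : A x -> R^o) | i <- enum I] *
    eta x [seq e`_i | i : 'I_(\dim {:A x}) <- enum I].

(* The form whose value on vectors of A_x is the value at x of T on smooth
   sections through these vectors (for tensorial T, any such sections). *)
Definition form_of_tensor (T : seq (section A) -> M -> R) : form_field :=
  fun x vs =>
    let ext v := xget (fun y => 0) [set a : section A | smooth_section a /\ a x = v]
    in
    T [seq ext v | v <- vs] x.

End Fields.

Arguments mv_of_fun {R n M r} A f x s.
Arguments mv_of_section {R n M r A} a x s.
Arguments form_of_tensor {R n M r A} T x vs.

(** * Skew algebroids *)

Record skew_algebroid (R : realType) (n : nat) (M : manifold R n) (r : nat) :=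
  SkewAlgebroid {
  bundle :> vbundle M r;
  anchor : forall x, bundle x -> (M -> R) -> R;
  anchor_tangent : forall x (v : bundle x), tangent x (anchor v);
  anchor_linear : forall x (k : R) (u v : bundle x) (f : M -> R),
    anchor (k *: u + v) f = k * anchor u f + anchor v f;
  anchor_smooth : forall (a : section bundle) (f : M -> R),
    smooth_section a -> smooth f -> smooth (fun x => anchor (a x) f);
  bracket : section bundle -> section bundle -> section bundle;
  bracket_smooth : forall a b, smooth_section a -> smooth_section b ->
    smooth_section (bracket a b);
  bracket_skew : forall a b, smooth_section a -> smooth_section b ->
    forall x, bracket a b x = - bracket b a x;
  bracket_linear : forall (k : R) a b c,
    smooth_section a -> smooth_section b -> smooth_section c ->
    forall x, bracket a (fun y => k *: b y + c y) x =
              k *: bracket a b x + bracket a c x;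
  bracket_leibniz : forall (f : M -> R) a b,
    smooth f -> smooth_section a -> smooth_section b ->
    forall x, bracket a (fun y => f y *: b y) x =
              f x *: bracket a b x + anchor (a x) f *: b x
}.

Section Calculus.
Context {R : realType} {n : nat} {M : manifold R n} {r : nat}.
Variable A : skew_algebroid M r.
Implicit Types (a : section A) (eta : form_field A) (P Q : mv_field A).

Definition rho a (f : M -> R) : M -> R := fun x => anchor (a x) f.

Definition zero_section : section A := fun x => 0.

Definition omit (T : Type) (i : nat) (s : seq T) := take i s ++ drop i.+1 s.

Definition dform eta : form_field A :=
  form_of_tensor (fun s x =>
    \sum_(i < size s)
      (-1) ^+ i * rho (nth zero_section s i) (eval_form eta (omit i s)) x +
    \sum_(j < size s) \sum_(i < j)
      (-1) ^+ (i + j) *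
      eval_form eta (bracket (nth zero_section s i) (nth zero_section s j)
                     :: omit i (omit j s)) x).

Definition lie_form a eta : form_field A :=
  form_of_tensor (fun s x =>
    rho a (eval_form eta s) x -
    \sum_(i < size s)
      eval_form eta (take i s ++ bracket a (nth zero_section s i)
                     :: drop i.+1 s) x).

Arguments dform eta x vs : clear implicits.
Arguments lie_form a eta x vs : clear implicits.

(* Q is the Lie derivative of P along a. *)
Definition is_lie_mv a P Q : Prop :=
  forall eta, smooth_form eta -> forall x,
    pairing Q eta x = rho a (pairing P eta) x - pairing P (lie_form a eta) x.

(* These properties characterize the Schouten-Nijenhuis bracket: it is the
   unique B satisfying them, up to its values on non-smooth arguments. *)
Record is_schouten (B : mv_field A -> mv_field A -> mv_field A) : Prop := IsSchouten {
  schouten_smooth : forall P Q, smooth_mvector P -> smooth_mvector Q ->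
    smooth_mvector (B P Q);
  schouten_linearl : forall (k : R) P P' Q,
    smooth_mvector P -> smooth_mvector P' -> smooth_mvector Q ->
    forall x s, B (fun y t => k * P y t + P' y t) Q x s =
                k * B P Q x s + B P' Q x s;
  schouten_linearr : forall (k : R) P Q Q',
    smooth_mvector P -> smooth_mvector Q -> smooth_mvector Q' ->
    forall x s, B P (fun y t => k * Q y t + Q' y t) x s =
                k * B P Q x s + B P Q' x s;
  schouten_fun : forall f g : M -> R, smooth f -> smooth g ->
    forall x s, B (mv_of_fun A f) (mv_of_fun A g) x s = 0;
  schouten_section : forall a P, smooth_section a -> smooth_mvector P ->
    is_lie_mv a P (B (mv_of_section a) P);
  schouten_sym : forall k l P Q, smooth_mvector P -> mv_degree k P ->
    smooth_mvector Q -> mv_degree l Q ->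
    forall x s, B P Q x s = (-1) ^+ (k * l) * B Q P x s;
  schouten_wedge : forall k l P Q S, smooth_mvector P -> mv_degree k P ->
    smooth_mvector Q -> mv_degree l Q -> smooth_mvector S ->
    forall x s, B P (fun y => ext_wedge (Q y) (S y)) x s =
      ext_wedge (B P Q x) (S x) s +
      (-1) ^+ (k.+1 * l) * ext_wedge (Q x) (B P S x) s
}.

Definition is_jacobi (B : mv_field A -> mv_field A -> mv_field A)
    (Pi : mv_field A) (xi : section A) : Prop :=
  [/\ smooth_mvector Pi /\ mv_degree 2 Pi, smooth_section xi,
      forall x s, B Pi Pi x s = 2 * ext_wedge (mv_of_section xi x) (Pi x) s
    & is_lie_mv xi Pi (fun _ _ => 0)].

Definition nondeg_form (Omega : form_field A) : Prop :=
  forall x (v : A x), (forall w, Omega x [:: v; w] = 0) -> v = 0.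

Definition is_lcs (Omega theta : form_field A) : Prop :=
  [/\ [/\ smooth_form Omega, form_degree 2 Omega & nondeg_form Omega],
      smooth_form theta /\ form_degree 1 theta,
      forall x s, dform theta x s = 0
    & forall x s, dform Omega x s + ext_wedge (theta x) (Omega x) s = 0].

Definition flat (Omega : form_field A) (x : M) : 'Hom(A x, cofiber A x) :=
  linfun (fun v => linfun (fun w => - Omega x [:: v; w] : R^o) : cofiber A x).

Definition sharp (Omega : form_field A) (x : M) : cofiber A x -> A x :=
  (flat Omega x)^-1%VF.

Definition covector (theta : form_field A) (x : M) : cofiber A x :=
  linfun (fun v => theta x [:: v] : R^o).

Definition contra_Pi (Omega : form_field A) : mv_field A := fun x s =>
  if s is [:: alpha; beta]
  then Omega x [:: sharp Omega alpha; sharp Omega beta] else 0.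

Definition contra_xi (Omega theta : form_field A) : section A :=
  fun x => sharp Omega (covector theta x).

End Calculus.

(* Main.v *)
From HB Require Import structures.
Require Import Defs.
From mathcomp Require Import all_boot all_order all_algebra ring lra zify.
From mathcomp Require Import all_classical all_reals topology normedtype derive.
From mathcomp Require Import landau sequences exp realfun.

(** Let flat v = - Omega(v, .) with inverse sharp, and for sections a, v, w put
    (L_a Omega)(v, w) = rho(a).Omega(v, w) - Omega([a, v], w) - Omega(v, [a, w]).
    The bivector Pi is Omega transported by the musical isomorphisms:
    Pi(flat v, flat w) = Omega(v, w).  Differentiating this relation gives
    - [a, Pi](flat v, flat w) = - (L_a Omega)(v, w) for every section a
      (schouten_section_Pi_flat), and
    - [Pi, Pi](flat u, flat v, flat w) = 2 (d Omega)(u, v, w)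
      (schouten_Pi_Pi_flat).
    Since xi = sharp theta, the trivector xi /\ Pi corresponds in the same way to
    the opposite of theta /\ Omega (wedge_xi_Pi).  So [Pi, Pi] = 2 xi /\ Pi says
    exactly that d Omega + theta /\ Omega = 0 (Pi_equationP).  When this holds,
    the identities i_xi Omega = - theta and i_xi (theta /\ Omega) = 0 turn the
    expansion of d Omega(xi, v, w) into L_xi Omega = - d theta, that is
    [xi, Pi](flat v, flat w) = (d theta)(v, w) (schouten_xi_Pi), so the two
    remaining conditions agree as well.

    The Schouten bracket is given only by its characteristic properties.  To
    compute it at a point x, take a local frame e_i with dual coframe eps_i; with
    f_i = sharp eps_i one has Pi = 1/2 sum_i e_i /\ f_i near x, and the Leibniz
    rule reduces every bracket of Pi to brackets of sections.  This decomposition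
    is preferred to the one with coefficients Pi^ij because it does not introduce
    derivatives of Pi^ij.  The e_i and f_i are only local, so they are multiplied
    by a smooth cut-off function phi: phi^2 Pi is then a global sum of products
    of global sections (Pi_decomposition), and if phi = 1 and d phi = 0 at x the
    factor phi^2 can be dropped at x (bracket_cutoff, schouten_cutoff).  This is
    the reason for the construction of bump functions (bump_exists).

    The values [a, f] = rho(a).f and [a, b] on functions and sections come from
    the description of [a, P] as a Lie derivative by duality with smooth forms,
    which determines a smooth multivector field (pairing_nondegenerate). *)

Set Implicit Arguments.
Unset Strict Implicit.
Unset Printing Implicit Defensive.

Import Order.TTheory GRing.Theory Num.Theory.
Import numFieldNormedType.Exports.
Local Open Scope classical_set_scope.
Local Open Scope ring_scope.

(** * Functions of class C^k on open sets *)

Section CkTheory.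
Context {R : realType} {n : nat}.
Implicit Types (V W : set 'rV[R]_n) (f g : 'rV[R]_n -> R).

Lemma Ck_pointwise k V f :
  Ck k V f <-> forall v, V v -> Ck k [set v] f.
Proof.
elim: k f => [|k IH] f /=; split.
- by move=> h v Vv _ ->; exact: h.
- by move=> h v Vv; exact: (h v Vv v erefl).
- move=> [h1 h2] v Vv; split=> [_ ->|i]; first exact: h1.
  by move: (h2 i) => /IH; apply.
- move=> h; split=> [v Vv|i]; first by have [+ _] := h v Vv; apply.
  by apply/IH => v /h [].
Qed.

(** Differentiability is a local property: the linear approximation of f at v
    also approximates any function that coincides with f near v. *)
Lemma near_eq_differentiable f g v :
  (\near v, f v = g v) -> differentiable f v -> differentiable g v.
Proof.
move=> fg df.
have /diff_locallyP [dc /eqaddoP dE] := df.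
have E : g \o shift v = cst (g v) + 'd f v +o_ (0 : 'rV[R]_n) id.
  apply/eqaddoP => e e0; have := dE e e0.
  have fg0 : \forall w \near (0 : 'rV[R]_n), f (w + v) = g (w + v).
    by rewrite (near_shift v) /=; near do rewrite /= sub0r subrK.
  apply: filterS2 fg0 => w fgw.
  suff -> : (g \o shift v - (cst (g v) + 'd f v)) w =
            (f \o shift v - (cst (f v) + 'd f v)) w by [].
  by rewrite !fctE /= -fgw (nbhs_singleton fg).
by apply/diff_locallyP; rewrite (diff_unique dc E).
Unshelve. all: by end_near. Qed.

(** The basic locality statement.  V has to be open, because the derivatives at a
    point of V depend on the values of the function around that point. *)
Lemma Ck_eq k V f g : open V -> {in V, f =1 g} -> Ck k V f -> Ck k V g.
Proof.
move=> oV; elim: k f g => [|k IH] f g fg /=.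
  move=> h v Vv.
  have E : \forall w \near v, f w = g w.
    by near=> w; apply: fg; rewrite inE; near: w; exact: open_nbhs_nbhs.
  rewrite /prop_for/continuous_at -(nbhs_singleton E).
  exact: cvg_trans (near_eq_cvg E) (h v Vv).
have E v : V v -> \forall w \near v, f w = g w.
  by move=> Vv; near=> w; apply: fg; rewrite inE; near: w; exact: open_nbhs_nbhs.
move=> [h1 h2]; split=> [v Vv|i].
  by apply: near_eq_differentiable (h1 v Vv); exact: E.
by apply: IH (h2 i) => v; rewrite inE => Vv; apply/near_eq_derive/E.
Unshelve. all: by end_near. Qed.

Lemma CkS k V f : Ck k.+1 V f -> Ck k V f.
Proof.
elim: k f => [|k IH] f; last by move=> [h1 h2]; split=> // i; apply: IH.
by move=> [h1 _] v Vv; exact/differentiable_continuous/h1.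
Qed.

Lemma Ck_cst k V c : Ck k V (fun=> c).
Proof.
elim: k c => [|k IH] c /=; first by move=> v _; exact: cst_continuous.
split=> [v _|i]; first exact: differentiable_cst.
by rewrite (_ : 'D_ _ _ = fun=> 0) //; apply/funext => v; rewrite derive_cst.
Qed.

Lemma CkD k V f g : open V -> Ck k V f -> Ck k V g ->
  Ck k V (fun v => f v + g v).
Proof.
move=> oV; elim: k f g => [|k IH] f g /=.
  by move=> hf hg v Vv; apply: continuousD; [exact: hf|exact: hg].
move=> [f1 f2] [g1 g2]; split=> [v Vv|i].
  by apply: differentiableD; [exact: f1|exact: g1].
apply: Ck_eq (IH _ _ (f2 i) (g2 i)) => // v; rewrite inE => Vv.
by rewrite -deriveD//; apply: diff_derivable; [exact: f1|exact: g1].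
Qed.

Lemma CkM k V f g : open V -> Ck k V f -> Ck k V g ->
  Ck k V (fun v => f v * g v).
Proof.
move=> oV; elim: k f g => [|k IH] f g hf hg.
  by move=> v Vv; apply: continuousM; [exact: hf|exact: hg].
have [f1 f2] := hf; have [g1 g2] := hg; split=> [v Vv|i].
  by apply: differentiableM; [exact: f1|exact: g1].
apply: Ck_eq (CkD oV (IH _ _ (CkS hf) (g2 i)) (IH _ _ (CkS hg) (f2 i))) => // v.
rewrite inE => Vv.
by rewrite -[RHS]/('D__ (f * g) v) deriveM//; apply: diff_derivable;
  [exact: f1|exact: g1].
Qed.

(** If the derivatives of the functions h a are linear combinations of functions
    of the same family, then the derivatives of h a (f v) involve only the h b (f v)
    and the derivatives of f, so that an induction on k suffices.  Inverses and the
    flat function are treated in this way, without general composites of maps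
    between Euclidean spaces. *)
Lemma Ck_family_comp (I : Type) (h : I -> R -> R) (U : set R) V :
  open V ->
  (forall a t, U t -> derivable (h a) t 1) ->
  (forall a, exists s : seq (R * I), forall t, U t ->
      derive1 (h a) t = \sum_(p <- s) p.1 * h p.2 t) ->
  forall k a f, (forall v, V v -> U (f v)) -> Ck k V f ->
  Ck k V (fun v => h a (f v)).
Proof.
move=> oV hd hs; elim=> [|k IH] a f fU hf.
  move=> v Vv; apply: (@continuous_comp _ _ _ f (h a)); first exact: hf.
  by apply/differentiable_continuous/derivable1_diffP/hd/fU.
have [f1 f2] := hf.
have dh v : V v -> differentiable (h a) (f v).
  by move=> Vv; apply/derivable1_diffP/hd/fU.
split=> [v Vv|i]; first by apply: (differentiable_comp (f1 v Vv) (dh v Vv)).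
have [s sE] := hs a.
apply: (@Ck_eq _ _ (fun v => (\sum_(p <- s) p.1 * h p.2 (f v)) *
                             'D_(delta_mx 0 i) f v)) => //.
  move=> v; rewrite inE => Vv.
  have dc : differentiable (h a \o f) v.
    by apply: differentiable_comp; [exact: f1|exact: dh].
  rewrite (_ : (fun w => h a (f w)) = h a \o f)// (deriveE _ dc).
  rewrite (diff_comp (f1 v Vv) (dh v Vv)).
  rewrite /= (deriveE _ (f1 v Vv)) (deriv1E (hd a _ (fU v Vv))) -?sE; last exact: fU.
  by rewrite mulrC.
apply: CkM => //; last exact: f2.
elim: s {sE} => [|p s IHs].
  by under eq_fun do rewrite big_nil; exact: Ck_cst.
under eq_fun do rewrite big_cons.
apply: CkD => //; apply: CkM => //; first exact: Ck_cst.
by apply: IH => //; exact: CkS.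
Qed.
End CkTheory.

(** * A flat function *)

Section Flat.
Context {R : realType}.

(** For m = 0 this is the classical smooth function which is flat at 0; the factor
    t^-m makes the family stable under derivation. *)
Definition flatfun (m : nat) (t : R) : R :=
  if 0 < t then t^-1 ^+ m * expR (- t^-1) else 0.

(** This bound makes the function and its difference quotient at 0 tend to 0; it
    comes from exp s >= s^(m+1) / (m+1)! with s = 1/t. *)
Lemma flatfun_le m (t : R) : 0 <= flatfun m t <= m.+1`!%:R * `|t|.
Proof.
rewrite /flatfun; case: ifPn => [t0|_]; last by rewrite lexx mulr_ge0.
have ti0 : 0 < t^-1 by rewrite invr_gt0.
rewrite mulr_ge0 ?exprn_ge0 ?expR_ge0 ?(ltW ti0)//=.
have h : t^-1 ^+ m.+1 / m.+1`!%:R <= expR t^-1.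
  by apply: le_trans (expR_ge1Dxn m (ltW ti0)); rewrite lerDr.
move: h; rewrite (@ler_pdivrMr R (m.+1`!%:R)) ?ltr0n ?fact_gt0// => h.
rewrite expRN gtr0_norm//.
rewrite ler_pdivrMr ?expR_gt0//.
have -> : t^-1 ^+ m = t * t^-1 ^+ m.+1 by rewrite exprS mulVKf// gt_eqF.
by rewrite mulrAC [leRHS]mulrC ler_pM2l// mulrC.
Qed.

Lemma flatfun_derive m (t : R) :
  is_derive t 1 (flatfun m) (- m%:R * flatfun m.+1 t + flatfun m.+2 t).
Proof.
have [t0|t0|->] := ltrgtP t 0.
- have -> : - m%:R * flatfun m.+1 t + flatfun m.+2 t = 0.
    by rewrite /flatfun (lt_gtF t0) mulr0 addr0.
  apply: (near_eq_is_derive (f := cst (0 : R))).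
  near=> s; rewrite /flatfun (_ : (0 < s) = false)//.
  by apply/lt_gtF; near: s; exact: lt_nbhsl.
- have tn0 : t != 0 by rewrite gt_eqF.
  have d1 := is_deriveV tn0 (is_derive_id t (1 : R)).
  have d2 := is_deriveX m d1.
  have d3 := is_derive1_comp (is_derive_expR _) (is_deriveN d1).
  apply: is_derive_eq; first apply: near_eq_is_derive (is_deriveM d2 d3).
    near=> s; have s0 : 0 < s by near: s; exact: lt_nbhsr.
    by rewrite /flatfun s0 !fctE.
  rewrite /flatfun t0 /= !fctE /GRing.scale /=.
  case: m {d2} => [|m]; rewrite /= ?expr0 !exprS; by field.
- have -> : - m%:R * flatfun m.+1 0 + flatfun m.+2 0 = 0 :> R.
    by rewrite /flatfun ltxx mulr0 addr0.
  (* flatfun m z = z * flatfun m.+1 z: the slope at 0 is the next function of the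
     family, which is continuous at 0. *)
  apply/is_derive1_caratheodory; exists (flatfun m.+1); split.
  + move=> z; rewrite /flatfun ltxx !subr0; case: ifPn => [z0|_]; last by rewrite mul0r.
    by rewrite exprS; field; rewrite gt_eqF.
  + rewrite /prop_for /continuous_at {2}/flatfun ltxx.
    apply: (@squeeze_cvgr _ _ _ _ (cst 0) (fun t => m.+2`!%:R * `|t|)).
    * by near=> s; exact: flatfun_le.
    * exact: cvg_cst.
    * have h : {for (0 : R), continuous (fun t : R => m.+2`!%:R * `|t|)}.
        by apply: continuousM; [exact: cst_continuous|exact: norm_continuous].
      by move: h; rewrite /prop_for /continuous_at normr0 mulr0.
  + by rewrite /flatfun ltxx.
Unshelve. all: by end_near. Qed.

Lemma Ck_flat n k m (V : set 'rV[R]_n) f : open V -> Ck k V f ->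
  Ck k V (fun v => flatfun m (f v)).
Proof.
move=> oV; apply: (@Ck_family_comp _ _ _ flatfun setT) => //.
  by move=> a t _; have [] := flatfun_derive a t.
move=> a; exists [:: (- a%:R, a.+1); (1, a.+2)] => t _.
rewrite derive1E; have [_ ->] := flatfun_derive a t.
by rewrite !big_cons big_nil /= mul1r addr0.
Qed.

Lemma Ck_inv n k (V : set 'rV[R]_n) f : open V ->
  (forall v, V v -> f v != 0) -> Ck k V f -> Ck k V (fun v => (f v)^-1).
Proof.
move=> oV f0 hf.
have D a (t : R) : t != 0 -> is_derive t 1 (fun t => t^-1 ^+ a.+1)
  (- a.+1%:R * t^-1 ^+ a.+2).
  move=> t0; have d1 := is_deriveV t0 (is_derive_id t (1 : R)).
  have -> : (fun t : R => t^-1 ^+ a.+1) = (fun t => t^-1) ^+ a.+1.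
    by apply/funext => s; rewrite !fctE.
  apply: is_derive_eq (is_deriveX a.+1 d1) _.
  by rewrite /= /GRing.scale /= !exprS; field.
apply: (@Ck_family_comp _ _ _ (fun a t => t^-1 ^+ a.+1) [set t | t != 0] _ oV _ _ k 0)
  => //=.
  by move=> a t /(D a) [].
move=> a; exists [:: (- a.+1%:R, a.+1)] => t /(D a) [_ e].
by rewrite derive1E e big_cons big_nil addr0.
Qed.
End Flat.

(** * Smooth functions and bump functions on a manifold *)

Section SmoothOn.
Context {R : realType} {n : nat} {M : manifold R n}.
Implicit Types (U V : set M) (f g : M -> R).

Lemma chart_image c U :
  chart_map c @` (chart_dom c `&` U) =
  (chart_map c @` chart_dom c) `&` (@chart_inv _ _ M c) @^-1` U.
Proof.
apply/seteqP; split=> [_ [x [cx Ux] <-]|_ [[x cx <-]] /= ]; rewrite /= ?chart_mapK//.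
  by split=> //; exists x.
by move=> Ux; exists x.
Qed.

Lemma open_chart_image c U : open U -> open (chart_map c @` (chart_dom c `&` U)).
Proof.
move=> oU; rewrite chart_image.
have oc : open (@chart_map _ _ M c @` chart_dom c) by exact: chart_codom_open.
have := @chart_inv_continuous _ _ M c; rewrite (continuous_open_subspace _ oc).
by move=> /(continuous_inP _ oc); apply.
Qed.

(** Smoothness at a point only depends on a neighbourhood of this point. *)
Lemma smooth_on_glue U f :
  (forall x, U x -> exists2 V, V x & smooth_on V f) -> smooth_on U f.
Proof.
move=> h c k; apply/Ck_pointwise => _ [x [cx Ux] <-].
have [V Vx sV] := h x Ux.
by have /Ck_pointwise := sV c k; apply; exists x.
Qed.

Lemma smooth_onW U V f : U `<=` V -> smooth_on V f -> smooth_on U f.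
Proof. by move=> UV sV; apply: smooth_on_glue => x /UV; exists V. Qed.

Lemma smooth_on_eq U f g : open U -> (forall x, U x -> f x = g x) ->
  smooth_on U f -> smooth_on U g.
Proof.
move=> oU fg sf c k; apply: Ck_eq (sf c k); first exact: open_chart_image.
by move=> v; rewrite inE => -[x [cx Ux] <-] /=; rewrite chart_mapK//; exact: fg.
Qed.

Lemma smooth_on_cst U a : smooth_on U (fun=> a).
Proof. by move=> c k; exact: Ck_cst. Qed.

Lemma smooth_onD U f g : open U -> smooth_on U f -> smooth_on U g ->
  smooth_on U (fun x => f x + g x).
Proof.
by move=> oU sf sg c k; apply: CkD => //; [exact: open_chart_image|exact: sf|exact: sg].
Qed.

Lemma smooth_onM U f g : open U -> smooth_on U f -> smooth_on U g ->
  smooth_on U (fun x => f x * g x).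
Proof.
by move=> oU sf sg c k; apply: CkM => //; [exact: open_chart_image|exact: sf|exact: sg].
Qed.

Lemma smooth_onN U f : open U -> smooth_on U f -> smooth_on U (fun x => - f x).
Proof.
move=> oU sf; under eq_fun do rewrite -mulN1r.
by apply: smooth_onM => //; exact: smooth_on_cst.
Qed.

Lemma smooth_on_sum U (I : Type) (r : seq I) (P : pred I) (F : I -> M -> R) :
  open U -> (forall i, smooth_on U (F i)) ->
  smooth_on U (fun x => \sum_(i <- r | P i) F i x).
Proof.
move=> oU sF; elim: r => [|i r IH].
  by under eq_fun do rewrite big_nil; exact: smooth_on_cst.
by under eq_fun do rewrite big_cons; case: (P i) => //; apply: smooth_onD.
Qed.

Lemma smooth_on_prod U (I : Type) (r : seq I) (P : pred I) (F : I -> M -> R) :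
  open U -> (forall i, smooth_on U (F i)) ->
  smooth_on U (fun x => \prod_(i <- r | P i) F i x).
Proof.
move=> oU sF; elim: r => [|i r IH].
  by under eq_fun do rewrite big_nil; exact: smooth_on_cst.
by under eq_fun do rewrite big_cons; case: (P i) => //; apply: smooth_onM.
Qed.

Lemma smooth_onV U f : open U -> (forall x, U x -> f x != 0) ->
  smooth_on U f -> smooth_on U (fun x => (f x)^-1).
Proof.
move=> oU f0 sf c k; apply: Ck_inv; [exact: open_chart_image| |exact: sf].
by move=> _ [x [cx Ux] <-] /=; rewrite chart_mapK// f0.
Qed.

Lemma smooth_on_flat U f : open U -> smooth_on U f ->
  smooth_on U (fun x => flatfun 0 (f x)).
Proof.
by move=> oU sf c k; apply: Ck_flat; [exact: open_chart_image|exact: sf].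
Qed.

Lemma smooth_on_det U r (A : M -> 'M[R]_r) : open U ->
  (forall i j, smooth_on U (fun x => A x i j)) -> smooth_on U (fun x => \det (A x)).
Proof.
move=> oU sA; apply: smooth_on_sum => // s; apply: smooth_onM => //.
  exact: smooth_on_cst.
by apply: smooth_on_prod.
Qed.

(** Together with smooth_on_det and smooth_onV, this yields the smoothness of the
    inverse of a smooth invertible matrix, by Cramer's rule. *)
Lemma smooth_on_adj U r (A : M -> 'M[R]_r) : open U ->
  (forall i j, smooth_on U (fun x => A x i j)) ->
  forall i j, smooth_on U (fun x => (\adj (A x)) i j).
Proof.
move=> oU sA i j; under eq_fun do rewrite mxE.
apply: smooth_onM => //; first exact: smooth_on_cst.
apply: smooth_on_det => // k l.
by under eq_fun do rewrite !mxE; exact: sA.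
Qed.

(** The coordinates of a chart are smooth on its domain: this is the smoothness of
    the transition maps. *)
Lemma smooth_on_chart c i : smooth_on (chart_dom c) (fun x : M => chart_map c x 0 i).
Proof. by move=> d; exact: chart_transition. Qed.

(** The bump is a flat function of 1 - |v - v0|^2 / d^2 in a chart, extended by 0.
    Its support lies in the image K of a compact box; K is closed because the
    manifold is Hausdorff, and this makes the extension by 0 smooth. *)
Lemma bump_exists U x : open U -> U x ->
  exists (phi : M -> R) (K : set M),
   [/\ closed K, K `<=` U, forall y, ~ K y -> phi y = 0, smooth phi & phi x = 1].
Proof.
move=> oU Ux; have [c cx] := chart_cover x.
pose v0 := chart_map c x.
have : nbhs v0 (chart_map c @` (chart_dom c `&` U)).
  by apply: open_nbhs_nbhs; split; [exact: open_chart_image|exists x].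
move=> /nbhs_ballP [e /= e0 eB].
pose d := e / 2; have d0 : 0 < d by rewrite divr_gt0.
pose B := [set v : 'rV[R]_n | forall i, `[v0 0 i - d, v0 0 i + d]%classic (v ord0 i)].
have BW : B `<=` chart_map c @` (chart_dom c `&` U).
  move=> v Bv; apply: eB; split=> // i j; rewrite ord1.
  have := Bv j; rewrite /= in_itv /= => /andP[h1 h2].
  rewrite /ball /= ltr_norml; apply/andP; split; rewrite /d in h1 h2 d0; lra.
pose K := @chart_inv _ _ M c @` B.
have cK : compact K.
  apply: continuous_compact; last first.
    by apply: (rV_compact (A := fun i => `[v0 0 i - d, v0 0 i + d]%classic)) => i;
      exact: segment_compact.
  apply: continuous_subspaceW (@chart_inv_continuous _ _ M c).
  by move=> v /BW [y [cy _] <-]; exists y.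
pose g (v : 'rV[R]_n) := 1 - \sum_i ((v 0 i - v0 0 i) / d) ^+ 2.
have gB v : 0 < g v -> B v.
  move=> gv i; rewrite /= in_itv /=.
  have : ((v 0 i - v0 0 i) / d) ^+ 2 < 1.
    move: gv; rewrite /g subr_gt0; apply: le_lt_trans.
    by rewrite (bigD1 i)//= lerDl sumr_ge0// => j _; rewrite sqr_ge0.
  rewrite -real_normK ?num_real// expr_lt1// normrM normfV (gtr0_norm d0).
  by rewrite ltr_pdivrMr// mul1r ltr_norml => /andP[h1 h2]; apply/andP; split; lra.
have sg : smooth_on (chart_dom c) (fun y : M => g (chart_map c y)).
  have oc := @chart_dom_open _ _ M c.
  apply: smooth_onD => //; first exact: smooth_on_cst.
  apply: smooth_onN => //; apply: smooth_on_sum => // i.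
  under eq_fun do rewrite expr2.
  have s1 : smooth_on (chart_dom c) (fun y : M => (chart_map c y 0 i - v0 0 i) / d).
    apply: smooth_onM => //; last exact: smooth_on_cst.
    by apply: smooth_onD => //; [exact: smooth_on_chart|exact: smooth_on_cst].
  by apply: smooth_onM.
(* The factor expR 1 normalizes the value at x, since flatfun 0 1 = expR (- 1). *)
pose phi (y : M) := if `[< chart_dom c y >] then expR 1 * flatfun 0
  (g (chart_map c y)) else 0.
have phiE y : chart_dom c y -> phi y = expR 1 * flatfun 0 (g (chart_map c y)).
  by move=> cy; rewrite /phi asboolT.
have phi0 y : ~ K y -> phi y = 0.
  move=> nK; rewrite /phi; case: asboolP => // cy.
  rewrite /flatfun; case: ifPn => [gp|]; last by rewrite mulr0.
  by exfalso; apply: nK; exists (chart_map c y); [exact: gB|rewrite chart_mapK].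
exists phi, K; split => //.
- by apply: compact_closed => //; exact: manifold_hausdorff.
- by move=> _ [v /BW [y [cy Uy] <-] <-]; rewrite chart_mapK.
- apply: smooth_on_glue => y _; have [cy|ncy] := pselect (chart_dom c y).
    exists (chart_dom c) => //.
    have oc := @chart_dom_open _ _ M c.
    apply: (@smooth_on_eq _ (fun y => expR 1 * flatfun 0 (g (chart_map c y)))) => //.
      by move=> z cz; rewrite phiE.
    by apply: smooth_onM => //; [exact: smooth_on_cst|exact: smooth_on_flat].
  exists (~` K).
    move=> [v /BW [z [cz Uz] <-] zy]; apply: ncy; rewrite -zy chart_mapK//.
  apply: (@smooth_on_eq _ (fun=> 0)); last exact: smooth_on_cst.
    by rewrite openC; apply: compact_closed => //; exact: manifold_hausdorff.
  by move=> z /phi0.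
- rewrite phiE// -/v0 /g big1 ?subr0; last by move=> i _; rewrite subrr mul0r expr0n.
  by rewrite /flatfun ltr01 invr1 expr0 mul1r -expRD subrr expR0.
Qed.
End SmoothOn.

(** * Exterior products and alternating functions of lists *)

Section Wedge.
Context {R : realType} {V : vectType R}.
Implicit Types (P Q S : seq V -> R) (s : seq V).

Lemma inversions_cons b m :
  inversions (b :: m) = ((if b then 0 else count id m) + inversions m)%N.
Proof.
rewrite /inversions /= big_mkcond big_ord_recl /= -big_mkcond /=.
by case: b; rewrite /= ?add0n.
Qed.

Lemma inversions_nil : inversions [::] = 0%N.
Proof. by rewrite /inversions big_ord0. Qed.

Lemma big_tuple_cons k (F : seq bool -> R) :
  \sum_(m : k.+1.-tuple bool) F m =
  \sum_(m : k.-tuple bool) F (true :: m) + \sum_(m : k.-tuple bool) F (false :: m).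
Proof.
pose h (p : bool * k.-tuple bool) := [tuple of p.1 :: p.2].
rewrite (reindex h) /=; last first.
  exists (fun m => (thead m, [tuple of behead m])) => [[b m] _|m _] /=.
    by congr (_, _); apply: val_inj.
  by rewrite /h /= -tuple_eta.
rewrite -(pair_bigA _ (fun b (m : k.-tuple bool) => F (b :: m))) /=.
by rewrite big_bool.
Qed.

Lemma big_tuple_nil (F : seq bool -> R) : \sum_(m : 0.-tuple bool) F m = F [::].
Proof. by rewrite (big_pred1 [tuple]) // => m /=; apply/esym/eqP; exact: tuple0. Qed.

Lemma wedge_nil P Q : ext_wedge P Q [::] = P [::] * Q [::].
Proof.
rewrite /ext_wedge /=.
rewrite (big_tuple_nil (fun m => (-1) ^+ inversions m * P (mask m [::]) * Q
  (mask (map negb m) [::]))).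
by rewrite inversions_nil expr0 mul1r.
Qed.

(** A shuffle gives the head of the list either to P or to Q; in the second case
    the head moves across all the arguments given to P.  This recursion computes
    the products on explicit lists. *)
Lemma wedge_cons P Q x s :
  ext_wedge P Q (x :: s) =
  ext_wedge (fun t => P (x :: t)) Q s +
  ext_wedge (fun t => (-1) ^+ size t * P t) (fun t => Q (x :: t)) s.
Proof.
rewrite {1}/ext_wedge /=.
rewrite (big_tuple_cons _
  (fun m => (-1) ^+ inversions m * P (mask m (x :: s)) * Q
    (mask (map negb m) (x :: s)))).
congr (_ + _); apply: eq_bigr => m _ /=; rewrite inversions_cons //=.
by rewrite size_mask ?size_tuple// exprD mulrA [(-1) ^+ _ * (-1) ^+ _]mulrC.
Qed.

Lemma homogeneous_wedge k l P Q : homogeneous k P -> homogeneous l Q ->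
  homogeneous (k + l) (ext_wedge P Q).
Proof.
move=> hP hQ s hs; apply: big1 => m _.
have [e1|/hP->] := eqVneq (size (mask m s)) k; last by rewrite mulr0 mul0r.
have [e2|/hQ->] := eqVneq (size (mask (map negb m) s)) l; last by rewrite mulr0.
exfalso; move/eqP: hs; apply; rewrite -e1 -e2 !size_mask ?size_map ?size_tuple//.
rewrite count_map -{1}(size_tuple m) -(count_predC id); congr (_ + _)%N.
Qed.

Lemma wedge_deg0 c Q s : ext_wedge (deg0 c) Q s = c * Q s.
Proof.
rewrite /ext_wedge.
rewrite (bigD1 [tuple of nseq (size s) false]) //= big1 => [|m mf]; last first.
  rewrite /deg0; case e: (mask m s) => [|x t]; last by rewrite mulr0 mul0r.
  have : size (mask m s) = 0%N by rewrite e.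
  rewrite size_mask ?size_tuple// => /eqP; rewrite -leqn0 leqNgt -has_count => h.
  exfalso; move/eqP: mf; apply; apply/val_inj => /=.
  have : all (pred1 false) m.
    by apply/allP => b bm; apply: contraNT h => hb; apply/hasP; exists b => //;
      case: b hb bm.
  by move/all_pred1P; rewrite size_tuple.
rewrite mask_false map_nseq /= mask_true // addr0.
have -> : inversions (nseq (size s) false) = 0%N.
  by elim: (size s) => [|k IH]; rewrite ?inversions_nil// inversions_cons IH addn0
    count_nseq.
by rewrite expr0 mul1r.
Qed.

Definition wedge2 (f g : V -> R) s : R :=
  if s is [:: a; b] then f a * g b - f b * g a else 0.

Lemma wedge_deg1 f g : ext_wedge (deg1 f) (deg1 g) = wedge2 f g.
Proof.
have hh (h : V -> R) : homogeneous 1 (deg1 h) by case=> [|a [|b s]].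
have hw := homogeneous_wedge (hh f) (hh g).
apply/funext => s; have [sz|sz] := eqVneq (size s) 2; last first.
  by rewrite hw//; case: s sz => [|a [|b [|c s]]].
case: s sz => [|a [|b [|c s]]] // _; rewrite !wedge_cons !wedge_nil /= !expr0 !expr1;
  ring.
Qed.

Lemma wedge_12 P Q a b c : homogeneous 1 P -> homogeneous 2 Q ->
  ext_wedge P Q [:: a; b; c] =
  P [:: a] * Q [:: b; c] - P [:: b] * Q [:: a; c] + P [:: c] * Q [:: a; b].
Proof.
move=> hP hQ; rewrite !wedge_cons !wedge_nil /=.
rewrite (hP [:: a; b; c])// (hP [:: a; b])// (hP [:: a; c])// (hP [:: b; c])//
  (hP [::])//.
ring.
Qed.

Lemma wedge_21 P Q a b c : homogeneous 2 P -> homogeneous 1 Q ->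
  ext_wedge P Q [:: a; b; c] =
  P [:: a; b] * Q [:: c] - P [:: a; c] * Q [:: b] + P [:: b; c] * Q [:: a].
Proof.
move=> hP hQ; rewrite !wedge_cons !wedge_nil /=.
rewrite (hP [:: a; b; c])// (hP [:: a])// (hP [:: b])// (hP [:: c])// (hP [::])//.
ring.
Qed.

Lemma wedge0l P Q s : (forall t, P t = 0) -> ext_wedge P Q s = 0.
Proof. by move=> P0; rewrite /ext_wedge big1// => m _; rewrite P0 mulr0 mul0r. Qed.

Lemma wedge0r P Q s : (forall t, Q t = 0) -> ext_wedge P Q s = 0.
Proof. by move=> Q0; rewrite /ext_wedge big1// => m _; rewrite Q0 mulr0. Qed.

Lemma multilinear0 P s1 s2 : multilinear P -> P (s1 ++ 0 :: s2) = 0.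
Proof.
move=> mP; have := mP s1 s2 (-1) 0 0; rewrite scaler0 addr0 => e.
by move: e; rewrite mulN1r addNr.
Qed.

Lemma multilinear_sum P (I : Type) (r : seq I) (c : I -> R) (v : I -> V) s1 s2 :
  multilinear P ->
  P (s1 ++ (\sum_(i <- r) c i *: v i) :: s2) = \sum_(i <- r) c i * P (s1 ++ v i :: s2).
Proof.
move=> mP; elim: r => [|i r IH]; rewrite ?big_nil ?multilinear0// !big_cons.
by rewrite mP IH.
Qed.

Section Alternating.
Variable P : seq V -> R.
Hypotheses (mP : multilinear P) (aP : alternating P).

Lemma multilinearD s1 s2 u v : P (s1 ++ (u + v) :: s2) = P (s1 ++ u :: s2) +
    P (s1 ++ v :: s2).
Proof. by rewrite -[u in LHS]scale1r mP mul1r. Qed.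

Lemma alternating_swap s1 s2 u v : P (s1 ++ u :: v :: s2) = - P (s1 ++ v :: u :: s2).
Proof.
have a1 w : P (s1 ++ w :: w :: s2) = 0 by exact: (aP s1 [::]).
have D w : P (s1 ++ w :: (u + v) :: s2) = P (s1 ++ w :: u :: s2) +
  P (s1 ++ w :: v :: s2).
  by have := multilinearD (rcons s1 w) s2 u v; rewrite !cat_rcons.
have := a1 (u + v); rewrite multilinearD !D !a1 add0r addr0 => /eqP.
by rewrite addr_eq0 => /eqP.
Qed.

(** Only the vanishing is propagated, so that signs need not be tracked. *)
Lemma alternating_move p x t1 t2 :
  P (p ++ x :: t1 ++ t2) = 0 -> P (p ++ t1 ++ x :: t2) = 0.
Proof.
elim: t1 p => [|y t1 IH] p //= h.
by rewrite -cat_rcons IH// cat_rcons alternating_swap h oppr0.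
Qed.

Lemma alternating_perm p s t : perm_eq s t -> P (p ++ s) = 0 -> P (p ++ t) = 0.
Proof.
elim: s p t => [|x s IH] p t.
  by rewrite perm_sym => /perm_nilP ->.
move=> st; have xt : x \in t by rewrite -(perm_mem st) mem_head.
case/splitPr: xt st => t1 t2 st h; apply: alternating_move.
rewrite -cat_rcons; apply: IH; last by rewrite cat_rcons.
by rewrite -(perm_cons x) (perm_trans st)// perm_catC /= perm_cons perm_catC.
Qed.

(** An alternating function is determined by its values on the increasing lists of
    elements of a spanning family. *)
Lemma alternating_basis0 d (e : 'I_d -> V) :
  (forall v, exists c : 'I_d -> R, v = \sum_i c i *: e i) ->
  (forall I : {set 'I_d}, P [seq e i | i <- enum I] = 0) ->
  forall s, P s = 0.
Proof.
move=> span hI.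
have key (l : seq 'I_d) : P (map e l) = 0.
  have [ul|nul] := boolP (uniq l).
    apply: (@alternating_perm [::] _ (map e l)) (hI [set i in l]).
    apply: perm_map; apply: uniq_perm; rewrite ?enum_uniq// => i.
    by rewrite mem_enum inE.
  have : exists i l1 l2 l3, l = l1 ++ i :: l2 ++ i :: l3.
    elim: l nul => [|i l IH] //=; rewrite negb_and negbK => /orP[il|/IH].
      by case/splitPr: il => l2 l3; exists i, [::], l2, l3.
    by move=> [j [l1 [l2 [l3 ->]]]]; exists j, (i :: l1), l2, l3.
  by move=> [i [l1 [l2 [l3 ->]]]]; rewrite map_cat /= map_cat /= aP.
suff K s l : P (map e l ++ s) = 0 by move=> s; exact: (K s [::]).
elim: s l => [|v s IH] l; first by rewrite cats0.
have [c ->] := span v.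
rewrite multilinear_sum// big1// => i _.
by rewrite -cat_rcons -map_rcons IH mulr0.
Qed.
End Alternating.
End Wedge.

Lemma multilinear1D (R : realType) (V : vectType R) (P : seq V -> R) u v :
  multilinear P -> P [:: u + v] = P [:: u] + P [:: v].
Proof. by move=> m; exact: (multilinearD m [::] [::]). Qed.

Lemma multilinear1_sum (R : realType) (V : vectType R) (P : seq V -> R)
    (I : Type) (l : seq I) (c : I -> R) (v : I -> V) :
  multilinear P -> P [:: \sum_(i <- l) c i *: v i] = \sum_(i <- l) c i * P [:: v i].
Proof. exact: (@multilinear_sum _ _ P I l c v [::] [::]). Qed.

Lemma multilinear1Z (R : realType) (V : vectType R) (P : seq V -> R) k v :
  multilinear P -> P [:: k *: v] = k * P [:: v].
Proof.
move=> m; have := multilinear1_sum [:: tt] (fun=> k) (fun=> v) m.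
by rewrite !big_cons !big_nil !addr0.
Qed.

(** * Derivations, cut-off functions and smooth sections *)

Section Lin.
Context {R : realType} {U V : vectType R}.

(** For a map that satisfies linearity without carrying a bundled structure. *)
Lemma linfunE (f : U -> V) : linear f -> forall v, linfun f v = f v.
Proof.
move=> lf v.
pose fL : {linear U -> V} := HB.pack f (GRing.isLinear.Build _ _ _ _ f lf).
by rewrite (_ : linfun f = linfun fL)// lfunE.
Qed.

Lemma bij_lfunK (f : 'Hom(U, V)) : bijective f -> cancel f f^-1%VF /\ cancel f^-1%VF f.
Proof.
move=> bf; have K : cancel f f^-1%VF.
  by apply: lker0_lfunK; apply/lker0P; exact: bij_inj.
split=> // w; have [g gK Kg] := bf.
by rewrite -[w in LHS]Kg K Kg.
Qed.
End Lin.

(** Linear maps into the regular module, with the operations of their values stated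
    in the field itself, so that ring applies to them. *)
Section Covectors.
Context {R : realType} {V : vectType R}.
Implicit Types (f g : 'Hom(V, R^o)) (v w : V).

Lemma covecD f v w : f (v + w) = f v + f w :> R.
Proof. exact: linearD. Qed.

Lemma covecZ f k v : f (k *: v) = k * f v :> R.
Proof. exact: linearZ. Qed.

Lemma covecN f v : f (- v) = - f v :> R.
Proof. exact: linearN. Qed.

Lemma covec_sum f (I : Type) (s : seq I) (F : I -> V) :
  f (\sum_(i <- s) F i) = \sum_(i <- s) f (F i) :> R.
Proof. exact: linear_sum. Qed.

Lemma add_covec f g v : (f + g) v = f v + g v :> R.
Proof. exact: add_lfunE. Qed.

Lemma scale_covec k f v : (k *: f) v = k * f v :> R.
Proof. exact: scale_lfunE. Qed.

Lemma sum_covec (I : Type) (s : seq I) (F : I -> 'Hom(V, R^o)) v :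
  (\sum_(i <- s) F i) v = \sum_(i <- s) F i v :> R.
Proof. exact: sum_lfunE. Qed.
End Covectors.

Section Tangent.
Context {R : realType} {n : nat} {M : manifold R n} (x : M).
Variables (D : (M -> R) -> R) (tD : tangent x D).

Lemma smooth_cst a : smooth (fun _ : M => a).
Proof. exact: smooth_on_cst. Qed.

Lemma smoothD (f g : M -> R) : smooth f -> smooth g -> smooth (fun x => f x + g x).
Proof. by apply: smooth_onD; exact: openT. Qed.

Lemma smoothM (f g : M -> R) : smooth f -> smooth g -> smooth (fun x => f x * g x).
Proof. by apply: smooth_onM; exact: openT. Qed.

Lemma smoothN (f : M -> R) : smooth f -> smooth (fun x => - f x).
Proof. by apply: smooth_onN; exact: openT. Qed.

Lemma smooth_sum (I : Type) (r : seq I) (P : pred I) (F : I -> M -> R) :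
  (forall i, smooth (F i)) -> smooth (fun x => \sum_(i <- r | P i) F i x).
Proof. by apply: smooth_on_sum; exact: openT. Qed.

Lemma tangentD f g : smooth f -> smooth g -> D (fun y => f y + g y) = D f + D g.
Proof.
move=> sf sg; have [lin _ _] := tD; rewrite -[D f]mul1r -lin//.
by under [in RHS]eq_fun do rewrite mul1r.
Qed.

Lemma tangent0 : D (fun=> 0) = 0.
Proof.
have := tangentD (smooth_cst 0) (smooth_cst 0).
under eq_fun do rewrite addr0.
by move=> e; apply: (addrI (D (fun=> 0))); rewrite addr0 -e.
Qed.

Lemma tangent_scale k f : smooth f -> D (fun y => k * f y) = k * D f.
Proof.
move=> sf; have [lin _ _] := tD; have := lin k f (fun=> 0) sf (smooth_cst 0).
by rewrite tangent0 addr0; under eq_fun do rewrite addr0.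
Qed.

Lemma tangentM f g : smooth f -> smooth g ->
  D (fun y => f y * g y) = D f * g x + f x * D g.
Proof. by have [_ + _] := tD; apply. Qed.

Lemma tangentN f : smooth f -> D (fun y => - f y) = - D f.
Proof.
move=> sf; under eq_fun do rewrite -mulN1r.
by rewrite tangent_scale// mulN1r.
Qed.

Lemma tangentB f g : smooth f -> smooth g -> D (fun y => f y - g y) = D f - D g.
Proof. by move=> sf sg; rewrite tangentD ?tangentN//; exact: smoothN. Qed.

Lemma tangent_sum (I : Type) (r : seq I) (F : I -> M -> R) :
  (forall i, smooth (F i)) -> D (fun y => \sum_(i <- r) F i y) = \sum_(i <- r) D (F i).
Proof.
move=> sF; elim: r => [|i r IH].
  by under eq_fun do rewrite big_nil; rewrite big_nil tangent0.
under eq_fun do rewrite big_cons.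
by rewrite tangentD ?IH ?big_cons//; exact: smooth_sum.
Qed.
End Tangent.

Section Cutoff.
Context {R : realType} {n : nat} {M : manifold R n}.
Implicit Types (U V : set M).

(** A support in a closed set contained in U, and not mere vanishing outside U, is
    what allows products with functions on U to be extended by 0. *)
Definition cutoff U (phi : M -> R) : Prop :=
  smooth phi /\ exists K, [/\ closed K, K `<=` U & forall y, ~ K y -> phi y = 0].

Lemma cutoff_out U phi y : cutoff U phi -> ~ U y -> phi y = 0.
Proof. by move=> [_ [K [_ KU K0]]] nU; apply: K0 => /KU. Qed.

(** The extension by 0 of phi * f is smooth on the part of U and on the complement
    of the support of phi, two open sets that cover V. *)
Lemma smooth_on_cutoff U V phi f : open U -> open V -> cutoff U phi ->
  smooth_on (V `&` U) f -> smooth_on V (fun y => phi y * f y).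
Proof.
move=> oU oV [sphi [K [cK KU K0]]] sf; apply: smooth_on_glue => y Vy.
have [Uy|nUy] := pselect (U y).
  exists (V `&` U) => //; apply: smooth_onM => //; first exact: openI.
  exact: smooth_onW sphi.
exists (~` K); first by move=> /KU.
apply: (@smooth_on_eq _ _ _ _ (fun=> 0)); first by rewrite openC.
  by move=> z nK; rewrite K0 ?mul0r.
exact: smooth_on_cst.
Qed.

Lemma cutoff_exists U x : open U -> U x -> exists phi,
  [/\ cutoff U phi, phi x = 1 & forall D, tangent x D -> D phi = 0].
Proof.
move=> oU Ux; have [p [K [cK KU K0 sp px]]] := bump_exists oU Ux.
(* 2 p - p^2 = 1 - (1 - p)^2 is equal to 1 to the second order where p = 1, so p
   itself need not be constant near x. *)
exists (fun y => 2 * p y - p y * p y); split.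
- split; last by exists K; split=> // y /K0 ->; rewrite !mulr0 subr0.
  apply: smoothD; first by apply: smoothM => //; exact: smooth_cst.
  by apply: smoothN; exact: smoothM.
- by rewrite px; ring.
- move=> D tD; have s2 : smooth (fun y => 2 * p y) by apply: smoothM => //;
  exact: smooth_cst.
  have s3 : smooth (fun y => p y * p y) by exact: smoothM.
  rewrite (tangentB tD)// (tangent_scale tD)// (tangentM tD)// px; ring.
Qed.
End Cutoff.

(** Expand the arguments one after the other in the basis b. *)
Lemma smooth_on_multilinear (R : realType) n (M : manifold R n) (V : M -> vectType R)
    (Q : forall x, seq (V x) -> R) (U : set M) d (b : 'I_d -> forall x, V x)
    (J : Type) (tau : J -> forall x, V x) (g : J -> 'I_d -> M -> R) :
  open U -> (forall x, multilinear (Q x)) ->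
  (forall I : seq 'I_d, smooth_on U (fun x => Q x [seq b i x | i <- I])) ->
  (forall j i, smooth_on U (g j i)) ->
  (forall j x, U x -> tau j x = \sum_i g j i x *: b i x) ->
  forall l : seq J, smooth_on U (fun x => Q x [seq tau j x | j <- l]).
Proof.
move=> oU mQ sQ sg tE l.
suff K I : smooth_on U (fun x => Q x ([seq b i x | i <- I] ++ [seq tau j x | j <- l])).
  exact: (K [::]).
elim: l I => [|j l IH] I; first by under eq_fun do rewrite cats0; exact: sQ.
apply: (@smooth_on_eq _ _ _ _ (fun x => \sum_i g j i x *
    Q x ([seq b i x | i <- rcons I i] ++ [seq tau j x | j <- l]))) => //.
  move=> x Ux /=; rewrite (tE _ _ Ux) multilinear_sum//.
  by apply: eq_bigr => i _; rewrite map_rcons cat_rcons.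
by apply: smooth_on_sum => // i; apply: smooth_onM => //; exact: IH.
Qed.

Section Frames.
Context {R : realType} {n : nat} {M : manifold R n} {r : nat} {A : vbundle M r}.
Implicit Types (t u : triv A).

Lemma triv_frame t i x : triv_dom t x -> triv_map t x (frame t i x) = delta_mx 0 i.
Proof. by move=> tx; have [_] := bij_lfunK (triv_bij tx); apply. Qed.

Lemma coframeE t i x v : coframe t i x v = triv_map t x v 0 i.
Proof. by rewrite /coframe linfunE// => k u w; rewrite linearP !mxE. Qed.

Lemma coframe_frame t i j x : triv_dom t x -> coframe t i x (frame t j x) = (i == j)%:R.
Proof. by move=> tx; rewrite coframeE triv_frame// mxE eqxx. Qed.

Lemma frame_expand t x (v : A x) : triv_dom t x ->
  v = \sum_i coframe t i x v *: frame t i x.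
Proof.
move=> tx; have [K _] := bij_lfunK (triv_bij tx).
rewrite -[v in LHS]K [triv_map t x v in LHS]row_sum_delta linear_sum.
by apply: eq_bigr => i _; rewrite linearZ coframeE.
Qed.

Lemma coframe_expand t x (al : cofiber A x) : triv_dom t x ->
  al = \sum_i al (frame t i x) *: coframe t i x.
Proof.
move=> tx; apply/lfunP => v; rewrite sum_lfunE {1}(frame_expand v tx) linear_sum.
by apply: eq_bigr => i _; rewrite linearZ lfunE /= [LHS]mulrC.
Qed.

Lemma smooth_frame t u i j : smooth_on (triv_dom t `&` triv_dom u)
  (fun x => coframe u j x (frame t i x)).
Proof. by under eq_fun do rewrite coframeE; exact: triv_transition. Qed.

Implicit Types a b : section A.

Lemma smooth_sectionZ f a : smooth f -> smooth_section a ->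
  smooth_section (fun x => f x *: a x).
Proof.
move=> sf sa t i; under eq_fun do rewrite linearZ.
by apply: smooth_onM; [exact: triv_dom_open|exact: smooth_onW sf|exact: sa].
Qed.

Lemma smooth_section0 : smooth_section (fun x => 0 : A x).
Proof. by move=> t i; under eq_fun do rewrite linear0; exact: smooth_on_cst. Qed.

Lemma smooth_section_sum (I : Type) (s : seq I) (F : I -> section A) :
  (forall i, smooth_section (F i)) -> smooth_section (fun x => \sum_(i <- s) F i x).
Proof.
move=> sF t i; under eq_fun do rewrite linear_sum.
by apply: smooth_on_sum; [exact: triv_dom_open|move=> j; exact: sF].
Qed.

Lemma smooth_section_cutoff t phi a : cutoff (triv_dom t) phi ->
  (forall i, smooth_on (triv_dom t) (fun x => coframe t i x (a x))) ->
  smooth_section (fun x => phi x *: a x).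
Proof.
move=> cphi sa u i; under eq_fun do rewrite linearZ.
have ot : open (triv_dom t) by exact: triv_dom_open.
have ou : open (triv_dom u) by exact: triv_dom_open.
apply: (smooth_on_cutoff ot ou cphi).
apply: (@smooth_on_eq _ _ _ _
  (fun x => \sum_j coframe t j x (a x) * coframe u i x (frame t j x))).
- exact: (openI ou ot).
- move=> x [ux tx]; rewrite [in RHS](frame_expand (a x) tx) linear_sum.
  by apply: eq_bigr => j _; rewrite linearZ.
- apply: smooth_on_sum => [|j]; first exact: (openI ou ot).
  apply: smooth_onM; first exact: (openI ou ot).
    by apply: smooth_onW (sa j) => x [].
  by rewrite setIC; exact: smooth_frame.
Qed.

Lemma smooth_section_frame t phi i : cutoff (triv_dom t) phi ->
  smooth_section (fun x => phi x *: frame t i x).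
Proof.
move=> cphi; apply: (smooth_section_cutoff cphi) => j.
apply: (@smooth_on_eq _ _ _ _ (fun=> (j == i)%:R));
  [exact: triv_dom_open| |exact: smooth_on_cst].
by move=> x tx; rewrite coframe_frame.
Qed.

Lemma smooth_coframe t phi i a : cutoff (triv_dom t) phi -> smooth_section a ->
  smooth (fun x => phi x * coframe t i x (a x)).
Proof.
move=> cphi sa; apply: smooth_on_cutoff cphi _; [exact: triv_dom_open|exact: openT|].
by rewrite setTI; exact: sa.
Qed.

(** One factor phi makes the components global functions, the other makes the
    elements of the frame global sections. *)
Lemma section_cutoff t phi a x : cutoff (triv_dom t) phi ->
  (phi x * phi x) *: a x =
  \sum_i (phi x * coframe t i x (a x)) *: (phi x *: frame t i x).
Proof.
move=> cphi; have [tx|ntx] := pselect (triv_dom t x); last first.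
  rewrite (cutoff_out cphi ntx) mul0r scale0r big1// => i _.
  by rewrite scale0r scaler0.
rewrite [in LHS](frame_expand (a x) tx) scaler_sumr.
by apply: eq_bigr => i _; rewrite !scalerA mulrAC.
Qed.

Lemma section_through x (v : A x) : exists2 a : section A, smooth_section a & a x = v.
Proof.
have [t tx] := triv_cover A x.
have [phi [cphi phix _]] := cutoff_exists (@triv_dom_open _ _ _ _ _ t) tx.
exists (fun y => \sum_i coframe t i x v *: (phi y *: frame t i y)); last first.
  by rewrite phix [RHS](frame_expand v tx); apply: eq_bigr => i _; rewrite scale1r.
apply: smooth_section_sum => i; apply: smooth_sectionZ; first exact: smooth_cst.
exact: smooth_section_frame.
Qed.

Lemma smooth_form_eval (J : Type) (eta : form_field A) (a : J -> section A)
    (l : seq J) :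
  smooth_form eta -> (forall j, smooth_section (a j)) ->
  smooth (fun x => eta x [seq a j x | j <- l]).
Proof.
move=> [me se] sa; apply: smooth_on_glue => x _.
have [t tx] := triv_cover A x; exists (triv_dom t) => //.
apply: (@smooth_on_multilinear _ _ _ A eta (triv_dom t) r (frame t) J a
         (fun j i y => coframe t i y (a j y))).
- exact: triv_dom_open.
- by move=> y; have [] := me y.
- exact: se.
- by move=> j i; exact: sa.
- by move=> j y ty; exact: frame_expand.
Qed.

Lemma smooth_form1 eta a : smooth_form eta -> smooth_section a ->
  smooth (fun x => eta x [:: a x]).
Proof.
by move=> se sa; exact: (@smooth_form_eval unit eta (fun=> a) [:: tt]).
Qed.

Lemma smooth_form2 eta a b : smooth_form eta -> smooth_section a -> smooth_section b ->
  smooth (fun x => eta x [:: a x; b x]).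
Proof.
move=> se sa sb.
by apply: (@smooth_form_eval bool eta (fun c => if c then a else b) [:: true; false])
  => // -[].
Qed.

Lemma smooth_mvector_eval (Q : mv_field A) t (J : Type)
    (tau : J -> forall x, cofiber A x) (l : seq J) :
  smooth_mvector Q -> (forall j i, smooth_on (triv_dom t)
    (fun x => tau j x (frame t i x))) ->
  smooth_on (triv_dom t) (fun x => Q x [seq tau j x | j <- l]).
Proof.
move=> [mQ sQ] stau.
apply: (@smooth_on_multilinear _ _ _ (cofiber A) Q (triv_dom t) r (coframe t) J tau
         (fun j i y => tau j y (frame t i y))).
- exact: triv_dom_open.
- by move=> y; have [] := mQ y.
- exact: sQ.
- exact: stau.
- by move=> j y ty; exact: coframe_expand.
Qed.

End Frames.

(** * Multivector fields and their pairing with forms *)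

Section LowDegree.
Context {R : realType} {V : vectType R}.

Lemma multilinear_deg0 (c : R) : multilinear (deg0 c : seq V -> R).
Proof. by case=> [|? ?] s2 k u v; rewrite /= mulr0 addr0. Qed.

Lemma alternating_deg0 (c : R) : alternating (deg0 c : seq V -> R).
Proof. by case. Qed.

Lemma multilinear_deg1 (f : V -> R) : linear (f : V -> R^o) -> multilinear (deg1 f).
Proof.
move=> lf [|x [|y s1]] [|z s2] k u v; rewrite /= ?mulr0 ?addr0//.
exact: lf.
Qed.

Lemma alternating_deg1 (f : V -> R) : alternating (deg1 f).
Proof. by case=> [|x s1] [|y s2] s3 u //=; case: s1. Qed.

Lemma multilinear_wedge2 (f g : V -> R) : linear (f : V -> R^o) ->
    linear (g : V -> R^o) ->
  multilinear (wedge2 f g).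
Proof.
move=> lf lg [|x [|y s1]] [|z [|w s2]] k u v; rewrite /= ?mulr0 ?addr0//.
- rewrite (lf k u v) (lg k u v) /GRing.scale /=; ring.
- rewrite (lf k u v) (lg k u v) /GRing.scale /=; ring.
- by case: s1 => [|? ?]; rewrite ?mulr0 ?addr0.
- by case: s1 => [|? [|? ?]]; rewrite ?mulr0 ?addr0.
- by case: s1 => [|? [|? ?]]; rewrite ?mulr0 ?addr0.
Qed.

Lemma alternating_wedge2 (f g : V -> R) : alternating (wedge2 f g).
Proof.
case=> [|x s1] [|y s2] s3 u //=; last by case: s1 => // ? [].
- by case: s3 => //; rewrite mulrC subrr.
- by case: s2.
- by case: s1 => [|? []].
Qed.

Lemma homogeneous_deg0 (c : R) : homogeneous 0 (deg0 c : seq V -> R).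
Proof. by case. Qed.

Lemma homogeneous_deg1 (f : V -> R) : homogeneous 1 (deg1 f).
Proof. by case=> [|x []]. Qed.

Lemma homogeneous_wedge2 (f g : V -> R) : homogeneous 2 (wedge2 f g).
Proof. by case=> [|x [|y []]]. Qed.

End LowDegree.

Section Mvectors.
Context {R : realType} {n : nat} {M : manifold R n} {r : nat} {A : vbundle M r}.
Implicit Types (t u : triv A) (P Q : mv_field A) (a b : section A).

Lemma mv_ext P Q : (forall x s, P x s = Q x s) -> P = Q.
Proof. by move=> PQ; apply: functional_extensionality_dep => x; exact/funext. Qed.

Lemma linear_eval x (v : A x) : linear (fun al : cofiber A x => al v : R^o).
Proof. by move=> k al be; rewrite add_covec scale_covec. Qed.

Lemma smooth_mvZ f P : smooth f -> smooth_mvector P ->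
  smooth_mvector (fun x s => f x * P x s).
Proof.
move=> sf [mP sP]; split=> [x|t I].
  have [m al] := mP x; split=> [s1 s2 k u v|s1 s2 s3 u].
    by rewrite m; ring.
  by rewrite al mulr0.
by apply: smooth_onM; [exact: triv_dom_open|exact: smooth_onW sf|exact: sP].
Qed.

Lemma smooth_mvD P Q : smooth_mvector P -> smooth_mvector Q ->
  smooth_mvector (fun x s => P x s + Q x s).
Proof.
move=> [mP sP] [mQ sQ]; split=> [x|t I].
  have [m1 a1] := mP x; have [m2 a2] := mQ x; split=> [s1 s2 k u v|s1 s2 s3 u].
    by rewrite m1 m2; ring.
  by rewrite a1 a2 addr0.
by apply: smooth_onD; [exact: triv_dom_open|exact: sP|exact: sQ].
Qed.

Lemma smooth_mv0 : smooth_mvector ((fun x s => 0) : mv_field A).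
Proof.
split=> [x|t I]; last exact: smooth_on_cst.
by split=> // s1 s2 k u v; rewrite mulr0 addr0.
Qed.

Lemma smooth_mv_sum (I : Type) (s : seq I) (F : I -> mv_field A) :
  (forall i, smooth_mvector (F i)) -> smooth_mvector (fun x l => \sum_(i <- s) F i x l).
Proof.
move=> sF; elim: s => [|i s IH].
  rewrite (_ : (fun _ _ => _) = fun _ _ => 0); first exact: smooth_mv0.
  by apply: mv_ext => x l; rewrite big_nil.
rewrite (_ : (fun _ _ => _) = fun x l => F i x l + \sum_(i <- s) F i x l);
  first exact: smooth_mvD.
by apply: mv_ext => x l; rewrite big_cons.
Qed.

Lemma smooth_mv_fun f : smooth f -> smooth_mvector (mv_of_fun A f).
Proof.
move=> sf; split=> [x|t [|i I]]; last exact: smooth_on_cst.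
  by split; [exact: multilinear_deg0|exact: alternating_deg0].
exact: smooth_onW sf.
Qed.

Lemma smooth_mv_section a : smooth_section a -> smooth_mvector (mv_of_section a).
Proof.
move=> sa; split=> [x|t [|i [|j I]]]; try exact: smooth_on_cst.
  by split; [apply: multilinear_deg1; exact: linear_eval|exact: alternating_deg1].
exact: sa.
Qed.

Lemma smooth_mv_wedge a b : smooth_section a -> smooth_section b ->
  smooth_mvector (fun x => ext_wedge (mv_of_section a x) (mv_of_section b x)).
Proof.
move=> sa sb.
rewrite (_ : (fun x => _) = fun x => wedge2 (fun al : cofiber A x => al (a x))
  (fun al => al (b x))); last first.
  by apply: mv_ext => x s; rewrite -wedge_deg1.
split=> [x|t [|i [|j [|k I]]]]; try exact: smooth_on_cst.
  by split; [apply: multilinear_wedge2; exact: linear_eval|exact: alternating_wedge2].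
have ot : open (triv_dom t) by exact: triv_dom_open.
apply: smooth_onD => //; last apply: smooth_onN => //; apply: smooth_onM => //;
  first [exact: sa|exact: sb].
Qed.

Lemma mv_degree_section a : mv_degree 1 (mv_of_section a).
Proof. by move=> x; exact: homogeneous_deg1. Qed.

Lemma mv_degree_fun f : mv_degree 0 (mv_of_fun A f).
Proof. by move=> x; exact: homogeneous_deg0. Qed.

(** Let T be a bundle map from A to its dual.  The form eta = Q o T is smooth, and
    if T sends the basis used by the pairing at x to its dual basis, then the pairing
    of Q and eta at x is the sum of the squares of the components of Q. *)
Lemma pairing_nondegenerate Q x : smooth_mvector Q ->
  (forall eta, smooth_form eta -> pairing Q eta x = 0) -> forall s, Q x s = 0.
Proof.
move=> sQ Q0.
have [t tx] := triv_cover A x.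
have [phi [cphi phix _]] := cutoff_exists (@triv_dom_open _ _ _ _ _ t) tx.
pose e := vbasis {:A x}.
pose be i : cofiber A x := linfun (coord e i : A x -> R^o).
have beE i v : be i v = coord e i v by rewrite /be linfunE// => k u w; rewrite linearP.
(* G is the matrix, in the frame of t at x, of the scalar product for which the
   basis e is orthonormal; T uses the same coefficients at every point. *)
pose G j k := \sum_i coord e i (frame t j x) * coord e i (frame t k x).
pose T y (v : A y) : cofiber A y :=
  \sum_j \sum_k (phi y * G j k * coframe t j y v) *: coframe t k y.
have TL y : linear (T y).
  move=> c u v; rewrite /T scaler_sumr -big_split /=; apply: eq_bigr => j _.
  rewrite scaler_sumr -big_split /=; apply: eq_bigr => k _.
  by rewrite scalerA -scalerDl covecD covecZ; congr (_ *: _); ring.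
pose eta : form_field A := fun y vs => Q y (map (@T y) vs).
have seta : smooth_form eta.
  split=> [y|u I].
    have [mQ aQ] := sQ.1 y; split=> [s1 s2 c v w|s1 s2 s3 v].
      by rewrite /eta !map_cat /= TL mQ.
    by rewrite /eta !map_cat /= map_cat aQ.
  rewrite /eta; under eq_fun do rewrite -map_comp.
  apply: (@smooth_mvector_eval _ _ _ _ A Q u _ (fun i y => @T y (frame u i y))) =>
    // i j.
  rewrite /T.
  have ou : open (triv_dom u) by exact: triv_dom_open.
  have ot : open (triv_dom t) by exact: triv_dom_open.
  apply: (@smooth_on_eq _ _ _ _ (fun y => phi y * \sum_k \sum_l
    (G k l * coframe t k y (frame u i y) * coframe t l y (frame u j y)))) => //.
    move=> y uy; rewrite sum_covec mulr_sumr; apply: eq_bigr => k _.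
    rewrite sum_covec mulr_sumr; apply: eq_bigr => l _.
    by rewrite scale_covec !mulrA.
  apply: (smooth_on_cutoff ot ou cphi).
  have ou' := openI ou ot.
  apply: smooth_on_sum => // k; apply: smooth_on_sum => // l.
  apply: smooth_onM => //; last exact: smooth_frame.
  by apply: smooth_onM => //; [exact: smooth_on_cst|exact: smooth_frame].
have Tx v : T x v = \sum_i coord e i v *: be i.
  apply/lfunP => w; rewrite /T phix !sum_covec.
  transitivity (\sum_j \sum_k \sum_i coord e i (frame t j x) * coord e i (frame t k x)
     * (coframe t j x v * coframe t k x w)).
    apply: eq_bigr => j _; rewrite sum_covec; apply: eq_bigr => k _.
    by rewrite scale_covec /G mul1r -mulrA mulr_suml.
  under eq_bigr do rewrite exchange_big /=.
  rewrite exchange_big /=; apply: eq_bigr => i _.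
  rewrite scale_covec -!beE {2}(frame_expand v tx) {2}(frame_expand w tx).
  rewrite !covec_sum mulr_suml; apply: eq_bigr => j _.
  rewrite mulr_sumr; apply: eq_bigr => k _.
  by rewrite !covecZ !beE; ring.
have eb : basis_of {:A x} e by exact: vbasisP.
have Tb (i : 'I_(\dim {:A x})) : T x e`_i = be i.
  rewrite Tx (bigD1 i)//= big1 => [|j ji]; rewrite (coord_free _ _ (basis_free eb)).
    by rewrite eqxx scale1r addr0.
  by rewrite eq_sym (negbTE ji) scale0r.
have h := Q0 _ seta; have [mQ aQ] := sQ.1 x.
apply: (@alternating_basis0 _ _ _ mQ aQ _ be) => [al|I].
  exists (fun i => al e`_i); apply/lfunP => v.
  rewrite sum_covec {1}(coord_vbasis (memvf v)) covec_sum.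
  by apply: eq_bigr => i _; rewrite scale_covec beE covecZ mulrC.
have : \sum_(I : {set 'I_(\dim {:A x})}) Q x [seq be i | i <- enum I] ^+ 2 = 0.
  rewrite -[RHS]h /pairing; apply: eq_bigr => J _; rewrite expr2 /eta -map_comp.
  by congr (_ * Q x _); apply: eq_map => i /=; rewrite Tb.
move/eqP; rewrite psumr_eq0; last by move=> J _; exact: sqr_ge0.
by move=> /allP /(_ I); rewrite mem_index_enum => /(_ isT); rewrite sqrf_eq0 => /eqP.
Qed.
End Mvectors.

(** * The musical isomorphisms of a nondegenerate 2-form *)

Section Musical.
Context {R : realType} {n : nat} {M : manifold R n} {r : nat}.
Variables (A : skew_algebroid M r) (Om : form_field A).
Arguments Om : clear implicits.
Hypotheses (sOm : smooth_form Om) (ndOm : nondeg_form Om).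

Lemma Om_linearl x k (u v w : A x) : Om x [:: k *: u + v; w] = k * Om x [:: u; w] +
    Om x [:: v; w].
Proof. by have [m _] := sOm.1 x; exact: (m [::]). Qed.

Lemma Om_linearr x k (u v w : A x) : Om x [:: w; k *: u + v] = k * Om x [:: w; u] +
    Om x [:: w; v].
Proof. by have [m _] := sOm.1 x; exact: (m [:: w]). Qed.

Lemma Om_diag x (u : A x) : Om x [:: u; u] = 0.
Proof. by have [_ a] := sOm.1 x; exact: (a [::] [::]). Qed.

Lemma Om_skew x (u v : A x) : Om x [:: u; v] = - Om x [:: v; u].
Proof. by have [m a] := sOm.1 x; exact: (alternating_swap m a [::]). Qed.

Lemma flatE x (v w : A x) : flat Om x v w = - Om x [:: v; w].
Proof.
have l1 u : linear (fun w => - Om x [:: u; w] : R^o).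
  by move=> k a b; rewrite Om_linearr opprD -mulrN.
rewrite /flat linfunE; first by rewrite linfunE.
move=> k a b; apply/lfunP => c.
rewrite linfunE// add_lfunE scale_lfunE !linfunE//.
by rewrite Om_linearl opprD -mulrN.
Qed.

(** The matrix of flat in the frame and the coframe of t, acting on row vectors. *)
Definition gram (t : triv A) (x : M) : 'M[R]_r :=
  \matrix_(i, j) (- Om x [:: frame t i x; frame t j x]).

Lemma flat_frame t x (a : 'I_r -> R) j :
  flat Om x (\sum_i a i *: frame t i x) (frame t j x) = \sum_i a i * gram t x i j.
Proof.
rewrite flatE; have [m _] := sOm.1 x.
rewrite (multilinear_sum _ _ _ [::] [:: frame t j x] m) -sumrN.
by apply: eq_bigr => i _; rewrite mxE mulrN.
Qed.

Lemma flat_inj x : injective (flat Om x).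
Proof.
move=> u v uv; apply/subr0_eq/ndOm => w.
have e : flat Om x (u - v) = 0 by rewrite linearB /= uv subrr.
by apply/oppr_inj; rewrite -flatE e oppr0 lfunE.
Qed.

Lemma gram_det t x : triv_dom t x -> \det (gram t x) != 0.
Proof.
move=> tx; apply/negP => /det0P [v v0 vG].
have : \sum_i v 0 i *: frame t i x = 0.
  apply: (@flat_inj x); rewrite linear0 (coframe_expand (flat Om x _) tx) big1// => j _.
  have := congr1 (fun m : 'rV_r => m 0 j) vG; rewrite !mxE flat_frame => ->.
  by rewrite scale0r.
move=> e; move/negP: v0; apply; apply/eqP/rowP => j; rewrite mxE.
have := congr1 (coframe t j x) e; rewrite linear0 covec_sum (bigD1 j)//=.
rewrite covecZ coframe_frame// eqxx mulr1 big1 ?addr0// => i ij.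
by rewrite covecZ coframe_frame// eq_sym (negbTE ij) mulr0.
Qed.

Definition gram_inv t x : 'M[R]_r := (\det (gram t x))^-1 *: \adj (gram t x).

Lemma mul_gram_inv t x : triv_dom t x -> gram_inv t x *m gram t x = 1%:M.
Proof.
move=> tx; rewrite /gram_inv -scalemxAl mul_adj_mx scale_scalar_mx mulVf//.
exact: gram_det.
Qed.

(** Cramer's rule: an explicit preimage, which gives both the bijectivity of flat
    and the smoothness of sharp. *)
Lemma flat_surj t x (al : cofiber A x) : triv_dom t x ->
  flat Om x (\sum_i (\sum_j al (frame t j x) * gram_inv t x j i) *: frame t i x) = al.
Proof.
move=> tx; rewrite [RHS](coframe_expand al tx) (coframe_expand (flat Om x _) tx).
apply: eq_bigr => k _; congr (_ *: _); rewrite flat_frame.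
pose a : 'rV[R]_r := \row_j al (frame t j x).
have -> : al (frame t k x) = (a *m (gram_inv t x *m gram t x)) 0 k.
  by rewrite mul_gram_inv// mulmx1 mxE.
rewrite mulmxA mxE; apply: eq_bigr => i _; congr (_ * _).
by rewrite [RHS]mxE; apply: eq_bigr => j _; rewrite [a _ _]mxE.
Qed.

Lemma flatK x : cancel (flat Om x) (sharp Om (x := x)).
Proof. by apply: lker0_lfunK; apply/lker0P; exact: flat_inj. Qed.

Lemma sharpK x : cancel (sharp Om (x := x)) (flat Om x).
Proof.
move=> al; have [t tx] := triv_cover A x.
by rewrite -[al in LHS](flat_surj al tx) flatK flat_surj.
Qed.

Lemma sharp_flatE x (al : cofiber A x) w : al w = - Om x [:: sharp Om al; w].
Proof. by rewrite -flatE sharpK. Qed.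

Lemma sharp_frame t x (al : cofiber A x) : triv_dom t x ->
  sharp Om al = \sum_i (\sum_j al (frame t j x) * gram_inv t x j i) *: frame t i x.
Proof. by move=> tx; rewrite -[al in LHS](flat_surj al tx) flatK. Qed.

Lemma smooth_gram_inv t i j : smooth_on (triv_dom t) (fun x => gram_inv t x i j).
Proof.
have ot : open (triv_dom t) by exact: triv_dom_open.
have sg k l : smooth_on (triv_dom t) (fun x => gram t x k l).
  under eq_fun do rewrite mxE.
  by apply: smooth_onN => //; exact: (sOm.2 t [:: k; l]).
under eq_fun do rewrite mxE.
apply: smooth_onM => //; last exact: smooth_on_adj.
by apply: smooth_onV => //; [exact: gram_det|exact: smooth_on_det].
Qed.

Lemma smooth_on_sharp t (al : forall x, cofiber A x) :
  (forall j, smooth_on (triv_dom t) (fun x => al x (frame t j x))) ->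
  forall i, smooth_on (triv_dom t) (fun x => coframe t i x (sharp Om (al x))).
Proof.
move=> sal i; have ot : open (triv_dom t) by exact: triv_dom_open.
apply: (@smooth_on_eq _ _ _ _ (fun x => \sum_j al x (frame t j x) * gram_inv t x j i))
  => //.
  move=> x tx; rewrite (sharp_frame _ tx) covec_sum [RHS](bigD1 i)//=.
  rewrite covecZ coframe_frame// eqxx mulr1 [X in _ = _ + X]big1 ?addr0// => k ki.
  by rewrite covecZ coframe_frame// eq_sym (negbTE ki) mulr0.
by apply: smooth_on_sum => // j; apply: smooth_onM => //; exact: smooth_gram_inv.
Qed.

Lemma contra_Pi_flat x (u v : A x) :
  contra_Pi Om [:: flat Om x u; flat Om x v] = Om x [:: u; v].
Proof. by rewrite /contra_Pi !flatK. Qed.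

Lemma mv_degree_Pi : mv_degree 2 (contra_Pi Om).
Proof. by move=> x [|a [|b []]]. Qed.

Lemma smooth_Pi : smooth_mvector (contra_Pi Om).
Proof.
split=> [x|t [|i [|j [|k I]]]]; try exact: smooth_on_cst.
  have [m a] := sOm.1 x; split.
    move=> [|y [|z s1]] [|w [|w' s2]] k u v; rewrite /= ?mulr0 ?addr0//.
    + by rewrite /sharp linearP Om_linearl.
    + by rewrite /sharp linearP Om_linearr.
    + by case: s1 => [|? ?]; rewrite ?mulr0 ?addr0.
    + by case: s1 => [|? [|? ?]]; rewrite ?mulr0 ?addr0.
    + by case: s1 => [|? [|? ?]]; rewrite ?mulr0 ?addr0.
  case=> [|y s1] [|z s2] s3 u //=; last by case: s1 => // ? [].
  + by case: s3 => //; rewrite Om_diag.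
  + by case: s2.
  + by case: s1 => [|? []].
pose tau (i : 'I_r) (x : M) : A x := sharp Om (coframe t i x).
apply: (@smooth_on_multilinear _ _ _ A Om (triv_dom t) r (frame t) 'I_r tau
         (fun i k x => coframe t k x (tau i x)) _ _ _ _ _ [:: i; j]).
- exact: triv_dom_open.
- by move=> x; have [] := sOm.1 x.
- exact: sOm.2.
- move=> {}i k; apply: (@smooth_on_sharp t (coframe t i)) => l.
  apply: (@smooth_on_eq _ _ _ _ (fun=> (i == l)%:R));
    [exact: triv_dom_open| |exact: smooth_on_cst].
  by move=> x tx; rewrite coframe_frame.
- by move=> l x tx; exact: frame_expand.
Qed.

Section Dual.
Variables (t : triv A) (phi : M -> R).
Hypothesis cphi : cutoff (triv_dom t) phi.

Definition cut_frame (i : 'I_r) : section A := fun x => phi x *: frame t i x.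

Definition cut_dual (i : 'I_r) : section A := fun x =>
    phi x *: sharp Om (coframe t i x).

Lemma smooth_cut_frame i : smooth_section (cut_frame i).
Proof. exact: smooth_section_frame. Qed.

Lemma smooth_cut_dual i : smooth_section (cut_dual i).
Proof.
apply: (smooth_section_cutoff cphi); apply: (@smooth_on_sharp t (coframe t i)) => j.
apply: (@smooth_on_eq _ _ _ _ (fun=> (i == j)%:R));
  [exact: triv_dom_open| |exact: smooth_on_cst].
by move=> x tx; rewrite coframe_frame.
Qed.

(** Since sum_i al(e_i) f_i = sharp al, the right-hand side evaluated on al, be is
    half of be(sharp al) - al(sharp be), and both terms are equal to Pi(al, be). *)
Lemma Pi_decomposition : (fun x s => (phi x * phi x) * contra_Pi Om s) =
  (fun x s => \sum_i 2^-1 * ext_wedge (mv_of_section (cut_frame i) x)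
    (mv_of_section (cut_dual i) x) s).
Proof.
apply: mv_ext => x s; rewrite /mv_of_section.
under eq_bigr do rewrite wedge_deg1.
have [sz|sz] := eqVneq (size s) 2; last first.
  rewrite (mv_degree_Pi sz) mulr0 big1// => i _.
  by rewrite homogeneous_wedge2// mulr0.
case: s sz => [|al [|be []]]//= _.
have [tx|ntx] := pselect (triv_dom t x); last first.
  rewrite /cut_frame /cut_dual (cutoff_out cphi ntx) mul0r mul0r big1// => i _.
  by rewrite !scale0r !linear0 !mul0r subrr mulr0.
have D (a b : cofiber A x) : \sum_i a (cut_frame i x) * b (cut_dual i x) =
    phi x * phi x * b (sharp Om a).
  have -> : sharp Om a = \sum_i a (frame t i x) *: sharp Om (coframe t i x).
    rewrite {1}(coframe_expand a tx) /sharp linear_sum.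
    by apply: eq_bigr => i _; rewrite linearZ.
  rewrite covec_sum mulr_sumr; apply: eq_bigr => i _.
  by rewrite /cut_frame /cut_dual !covecZ; ring.
rewrite -mulr_sumr sumrB !D.
have -> : be (sharp Om al) = - al (sharp Om be).
  by rewrite [be _]sharp_flatE [al _]sharp_flatE Om_skew.
rewrite [X in _ * X = _](_ : _ = - al (sharp Om be)); first by field.
by rewrite sharp_flatE opprK.
Qed.

End Dual.
End Musical.

(** * Brackets on a skew algebroid *)

#[local] Arguments lie_form {R n M r A} a eta x vs.
#[local] Arguments dform {R n M r A} eta x vs.

Section Calculus.
Context {R : realType} {n : nat} {M : manifold R n} {r : nat}.
Variable A : skew_algebroid M r.
Implicit Types (a b : section A) (f g : M -> R) (x : M).

Lemma smooth_rho a f : smooth_section a -> smooth f -> smooth (rho a f).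
Proof. exact: anchor_smooth. Qed.

Lemma anchor_sum x (I : Type) (l : seq I) (c : I -> R) (v : I -> A x) f :
  anchor (\sum_(i <- l) c i *: v i) f = \sum_(i <- l) c i * anchor (v i) f.
Proof.
elim: l => [|i l IH]; last by rewrite !big_cons anchor_linear IH.
rewrite !big_nil; have := anchor_linear (-1) 0 0 f (x := x) (s := A).
by rewrite scaler0 addr0 mulN1r addNr.
Qed.

Lemma bracket0 a x : smooth_section a -> bracket a (fun=> 0) x = 0.
Proof.
move=> sa; have s0 := @smooth_section0 _ _ _ _ A.
have := bracket_linear (-1) sa s0 s0 x.
rewrite (_ : (fun y => -1 *: 0 + 0 : A y) = (fun y => 0)).
  by rewrite scaleN1r addNr.
by apply: functional_extensionality_dep => y; rewrite scaler0 addr0.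
Qed.

Lemma bracket_lincomb (I : Type) (l : seq I) (g : I -> M -> R) (e : I -> section A) a
    x :
  smooth_section a -> (forall i, smooth (g i)) -> (forall i, smooth_section (e i)) ->
  bracket a (fun y => \sum_(i <- l) g i y *: e i y) x =
  \sum_(i <- l) (g i x *: bracket a (e i) x + rho a (g i) x *: e i x).
Proof.
move=> sa sg se; elim: l => [|i l IH].
  rewrite big_nil -[RHS](bracket0 x sa); congr (bracket a _ x).
  by apply: functional_extensionality_dep => y; rewrite big_nil.
rewrite big_cons -IH -bracket_leibniz// -[X in _ = X + _]scale1r -bracket_linear//.
- congr (bracket a _ x).
  by apply: functional_extensionality_dep => y; rewrite big_cons scale1r.
- exact: smooth_sectionZ.
- by apply: smooth_section_sum => j; exact: smooth_sectionZ.
Qed.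

(** Multiplication by the square of such a phi changes neither the value nor the
    first derivatives at x. *)
Definition cutoff_at (U : set M) x phi :=
  [/\ cutoff U phi, phi x = 1 & forall D, tangent x D -> D phi = 0].

Section At.
Variables (U : set M) (x : M) (phi : M -> R).
Hypothesis hphi : cutoff_at U x phi.

Lemma smooth_cutoff_sqr : smooth (fun y => phi y * phi y).
Proof. by have [[sphi _] _ _] := hphi; exact: smoothM. Qed.

Lemma tangent_cutoff_sqr D : tangent x D -> D (fun y => phi y * phi y) = 0.
Proof.
move=> tD; have [[sphi _] _ D0] := hphi.
by rewrite (tangentM tD)// D0// mul0r mulr0 addr0.
Qed.

Lemma tangent_cutoff D f : tangent x D -> smooth f ->
  D (fun y => (phi y * phi y) * f y) = D f.
Proof.
move=> tD sf; have [_ px _] := hphi; have s2 := smooth_cutoff_sqr.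
by rewrite (tangentM tD)// tangent_cutoff_sqr// px mul0r add0r !mul1r.
Qed.

Lemma bracket_cutoff a (s : section A) : smooth_section a -> smooth_section s ->
  bracket a (fun y => (phi y * phi y) *: s y) x = bracket a s x.
Proof.
move=> sa ss; have [_ px _] := hphi; rewrite bracket_leibniz//;
  last exact: smooth_cutoff_sqr.
by rewrite tangent_cutoff_sqr ?px ?mulr1 ?scale1r ?scale0r ?addr0//;
  exact: anchor_tangent.
Qed.

(** The bracket [a, s] at x from the components of s in an arbitrary generating
    family near x, although such components only exist after multiplication by
    phi^2. *)
Lemma bracket_expand (I : Type) (l : seq I) (g : I -> M -> R) (e : I -> section A) a
    (s : section A) :
  smooth_section a -> smooth_section s ->
  (forall i, smooth (g i)) -> (forall i, smooth_section (e i)) ->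
  (forall y, (phi y * phi y) *: s y = \sum_(i <- l) g i y *: e i y) ->
  bracket a s x = \sum_(i <- l) (g i x *: bracket a (e i) x + rho a (g i) x *: e i x).
Proof.
move=> sa ss sg se sE; rewrite -bracket_lincomb// -(bracket_cutoff sa ss).
by congr (bracket a _ x); apply: functional_extensionality_dep => y; rewrite sE.
Qed.
End At.

Lemma cutoff_at_exists t x : triv_dom (v := A) t x ->
    exists phi, cutoff_at (triv_dom t) x phi.
Proof. by move=> tx; apply: cutoff_exists tx; exact: triv_dom_open. Qed.

(** The Lie derivative of a form, evaluated on one section. *)
Definition lie_1form a (eta : form_field A) (s : section A) x : R :=
  rho a (fun y => eta y [:: s y]) x - eta x [:: bracket a s x].

(** In rho(a).eta(s) - eta([a, s]), the two terms that differentiate the components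
    of s cancel. *)
Lemma lie_1form_tensorial a eta x : smooth_section a -> smooth_form eta ->
  exists al : cofiber A x, forall s, smooth_section s -> lie_1form a eta s x = al (s x).
Proof.
move=> sa seta; have [t tx] := triv_cover A x.
have [phi hphi] := cutoff_at_exists tx; have [cphi px _] := hphi.
pose e i : section A := fun y => phi y *: frame t i y.
have se i : smooth_section (e i) by exact: smooth_section_frame.
exists (\sum_i lie_1form a eta (e i) x *: coframe t i x) => s ss.
pose g i y := phi y * coframe t i y (s y).
have sg i : smooth (g i) by exact: smooth_coframe.
have sE y : (phi y * phi y) *: s y = \sum_i g i y *: e i y by exact: section_cutoff.
have [m _] := seta.1 x.
have tD := anchor_tangent (a x).
rewrite /lie_1form (bracket_expand hphi sa ss sg se sE) big_split/=.
rewrite multilinear1D// !multilinear1_sum//.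
have -> : rho a (fun y => eta y [:: s y]) x =
    \sum_i (rho a (g i) x * eta x [:: e i x] + g i x * rho a
      (fun y => eta y [:: e i y]) x).
  rewrite /rho -(tangent_cutoff hphi tD); last exact: smooth_form1.
  rewrite (_ : (fun y => _) = fun y => \sum_i g i y * eta y [:: e i y]); last first.
    apply/funext => y; have [my _] := seta.1 y.
    by rewrite -(multilinear1_sum _ _ _ my) -sE multilinear1Z.
  rewrite (tangent_sum tD) => [|i]; last by apply: smoothM => //; exact: smooth_form1.
  by apply: eq_bigr => i _; rewrite (tangentM tD)//; exact: smooth_form1.
rewrite sum_covec opprD addrA -!sumrB; apply: eq_bigr => i _.
rewrite scale_covec; have -> : coframe t i x (s x) = g i x by rewrite /g px mul1r.
by rewrite /lie_1form; ring.
Qed.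

(** The section chosen by form_of_tensor. *)
Definition ext x (v : A x) : section A :=
  xget (fun y => 0) [set a : section A | smooth_section a /\ a x = v].

Lemma extP x (v : A x) : smooth_section (ext v) /\ ext v x = v.
Proof.
have [a sa av] := section_through v.
by have := @xgetPex _ (fun y => 0) [set a : section A | smooth_section a /\ a x = v]
  (ex_intro _ a (conj sa av)).
Qed.

Lemma lie_form0 a eta x : lie_form a eta x [::] = rho a (fun y => eta y [::]) x.
Proof. by rewrite /lie_form /form_of_tensor /= big_ord0 subr0. Qed.

Lemma lie_form1 a eta x (v : A x) : lie_form a eta x [:: v] = lie_1form a eta (ext v) x.
Proof. by rewrite /lie_form /form_of_tensor /= big_ord_recl big_ord0 addr0. Qed.

Lemma pairing_fun f eta x : pairing (mv_of_fun A f) eta x = f x * eta x [::].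
Proof.
rewrite /pairing (bigD1 (finset.set0))//= enum_set0 /= big1 ?addr0// => I I0.
rewrite /mv_of_fun /deg0; case E: (enum I) => [|i l] /=; last by rewrite mul0r.
exfalso; move/negP: I0; apply; rewrite -cards_eq0 cardE E//.
Qed.

(** Stated without multilinearity of eta, since Lie derivatives of forms are not
    known to be multilinear. *)
Lemma pairing_section a eta x : pairing (mv_of_section a) eta x =
  \sum_i coord (vbasis {:A x}) i (a x) * eta x [:: (vbasis {:A x})`_i].
Proof.
rewrite /pairing (bigID (fun I : {set _} =>
  I \in [set [set i] | i : 'I_(\dim {:A x})]%SET)) /=.
rewrite [X in _ + X]big1 ?addr0 => [|I nI].
  rewrite big_imset /=; last by move=> i j _ _; exact: set1_inj.
  apply: eq_bigr => i _; rewrite enum_set1 /= linfunE// => k u w.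
  by rewrite linearP.
rewrite /mv_of_section /deg1; case E: (enum I) => [|i [|j l]] /=; try by rewrite mul0r.
exfalso; move/negP: nI; apply; apply/imsetP; exists i => //.
by apply/setP => j; rewrite -mem_enum E !inE.
Qed.

Lemma pairingB (P Q : mv_field A) eta x :
  pairing ((fun y t => -1 * P y t + Q y t) : mv_field A) eta x =
  pairing Q eta x - pairing P eta x :> R.
Proof. by rewrite /pairing -sumrB; apply: eq_bigr => I _; ring. Qed.

Lemma pairing_section_form a eta x : smooth_form eta ->
  pairing (mv_of_section a) eta x = eta x [:: a x].
Proof.
move=> seta; have [m _] := seta.1 x.
rewrite pairing_section [in RHS](coord_vbasis (memvf (a x))).
by rewrite multilinear1_sum.
Qed.

Lemma pairing_section_lie a b eta x : smooth_section a -> smooth_section b ->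
    smooth_form eta ->
  pairing (mv_of_section b) (lie_form a eta) x = lie_1form a eta b x.
Proof.
move=> sa sb seta; have [al alE] := lie_1form_tensorial x sa seta.
rewrite pairing_section alE// [in RHS](coord_vbasis (memvf (b x))) covec_sum.
apply: eq_bigr => i _; rewrite covecZ lie_form1.
by have [sE eE] := extP (vbasis {:A x})`_i; rewrite alE// eE.
Qed.

Section Bracket.
Variables (B : mv_field A -> mv_field A -> mv_field A) (hB : is_schouten B).
Arguments B : clear implicits.
Implicit Types P Q : mv_field A.

(** The form in which nondegeneracy is used for Lie derivatives of multivector
    fields, which are described by their pairings. *)
Lemma mv_eq_pairing P Q : smooth_mvector P -> smooth_mvector Q ->
  (forall eta, smooth_form eta -> forall x, pairing P eta x = pairing Q eta x) -> P = Q.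
Proof.
move=> sP sQ PQ; apply: mv_ext => x s.
have := @pairing_nondegenerate _ _ _ _ A (fun y s => -1 * P y s + Q y s) x.
move=> /(_ _ _ s) e; apply/eqP; rewrite -subr_eq0 -oppr_eq0 opprB; apply/eqP.
rewrite -e ?mulN1r 1?addrC//.
  apply: smooth_mvD => //.
  by apply: (smooth_mvZ (f := fun=> -1)) => //; exact: smooth_cst.
by move=> eta seta; rewrite pairingB PQ// subrr.
Qed.

Lemma schouten_section_fun a f : smooth_section a -> smooth f ->
  B (mv_of_section a) (mv_of_fun A f) = mv_of_fun A (rho a f).
Proof.
move=> sa sf; apply: mv_eq_pairing.
- by apply: schouten_smooth => //; [exact: smooth_mv_section|exact: smooth_mv_fun].
- by apply: smooth_mv_fun; exact: smooth_rho.
move=> eta seta x.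
rewrite (schouten_section hB sa (smooth_mv_fun (A := A) sf) seta) !pairing_fun
  lie_form0.
have -> : pairing (mv_of_fun A f) eta = fun y => f y * eta y [::].
  by apply/funext => y; rewrite pairing_fun.
have s0 : smooth (fun y => eta y [::]).
    by apply: (@smooth_form_eval _ _ _ _ A unit eta (fun _ _ => 0) [::]) => // _;
      exact: smooth_section0.
by rewrite /rho (tangentM (anchor_tangent (a x)))//; ring.
Qed.

Lemma schouten_section_section a b : smooth_section a -> smooth_section b ->
  B (mv_of_section a) (mv_of_section b) = mv_of_section (bracket a b).
Proof.
move=> sa sb; have sab := bracket_smooth sa sb; apply: mv_eq_pairing.
- by apply: schouten_smooth => //; exact: smooth_mv_section.
- exact: smooth_mv_section.
move=> eta seta x.
rewrite (schouten_section hB sa (smooth_mv_section sb) seta) pairing_section_lie//.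
rewrite pairing_section_form// /lie_1form.
have -> : pairing (mv_of_section b) eta = fun y => eta y [:: b y].
  by apply/funext => y; rewrite pairing_section_form.
by ring.
Qed.

Lemma schouten_fun_section a f : smooth_section a -> smooth f ->
  B (mv_of_fun A f) (mv_of_section a) = mv_of_fun A (rho a f).
Proof.
move=> sa sf; rewrite -schouten_section_fun//; apply: mv_ext => x s.
rewrite (schouten_sym hB (smooth_mv_fun (A := A) sf) (@mv_degree_fun _ _ _ _ A f)
  (smooth_mv_section sa) (@mv_degree_section _ _ _ _ A a)).
by rewrite mul0n expr0 mul1r.
Qed.

Lemma schouten0r P x s : smooth_mvector P -> B P (fun _ _ => 0) x s = 0.
Proof.
move=> sP; have s0 := @smooth_mv0 _ _ _ _ A.
have := schouten_linearr hB (-1) sP s0 s0 s.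
rewrite (_ : (fun y t => -1 * 0 + 0) = (fun _ _ => 0) :> mv_field A).
  by rewrite mulN1r addNr.
by apply: mv_ext => y t; rewrite mulr0 addr0.
Qed.

Lemma schouten_sumr P (I : Type) (l : seq I) k (F : I -> mv_field A) x s :
  smooth_mvector P -> (forall i, smooth_mvector (F i)) ->
  B P (fun y t => \sum_(i <- l) k * F i y t) x s = \sum_(i <- l) k * B P (F i) x s.
Proof.
move=> sP sF; elim: l => [|i l IH].
  rewrite big_nil -[RHS](schouten0r s sP); congr (B P _ x s).
  by apply: mv_ext => y t; rewrite big_nil.
rewrite big_cons -IH -(schouten_linearr hB)//.
  by congr (B P _ x s); apply: mv_ext => y t; rewrite big_cons.
by apply: smooth_mv_sum => j; apply: (smooth_mvZ (f := fun=> k)) => //;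
  exact: smooth_cst.
Qed.

(** The Schouten bracket is local: the Leibniz rule leaves only the term where f
    is not differentiated. *)
Lemma schouten_cutoff k P Q f x s : smooth_mvector P -> mv_degree k P ->
    smooth_mvector Q ->
  smooth f -> f x = 1 -> (forall t, B P (mv_of_fun A f) x t = 0) ->
  B P (fun y t => f y * Q y t) x s = B P Q x s.
Proof.
move=> sP dP sQ sf fx Pf.
have -> : (fun y t => f y * Q y t) = (fun y => ext_wedge (mv_of_fun A f y) (Q y)).
  by apply: mv_ext => y t; rewrite wedge_deg0.
rewrite (schouten_wedge hB sP dP (smooth_mv_fun (A := A) sf)
  (@mv_degree_fun _ _ _ _ A f) sQ).
rewrite muln0 expr0 mul1r wedge_deg0 fx mul1r.
rewrite /ext_wedge big1 ?add0r// => m _.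
by rewrite Pf mulr0 mul0r.
Qed.

End Bracket.
End Calculus.

(** * The Schouten brackets of the dual bivector *)

Section BivectorBrackets.
Context {R : realType} {n : nat} {M : manifold R n} {r : nat}.
Variables (A : skew_algebroid M r) (Om : form_field A).
Arguments Om : clear implicits.
Hypotheses (sOm : smooth_form Om) (ndOm : nondeg_form Om).
Variables (B : mv_field A -> mv_field A -> mv_field A) (hB : is_schouten B).
Arguments B : clear implicits.
Implicit Types (a b u v w : section A) (f g : M -> R) (x y : M).

(** (L_a Omega)(v, w). *)
Definition lie_2form a v w x : R :=
  rho a (fun y => Om y [:: v y; w y]) x
  - Om x [:: bracket a v x; w x] - Om x [:: v x; bracket a w x].

(** (d Omega)(u, v, w), for arbitrary sections and not only for the extensions of
    vectors that enter in dform. *)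
Definition d_2form u v w x : R :=
  rho u (fun y => Om y [:: v y; w y]) x - rho v (fun y => Om y [:: u y; w y]) x
  + rho w (fun y => Om y [:: u y; v y]) x
  - Om x [:: bracket u v x; w x] + Om x [:: bracket u w x; v x]
  - Om x [:: bracket v w x; u x].

Lemma rho_skew a v w x : smooth_section v -> smooth_section w ->
  rho a (fun y => Om y [:: v y; w y]) x = - rho a (fun y => Om y [:: w y; v y]) x.
Proof.
move=> sv sw; rewrite /rho -(tangentN (anchor_tangent (a x))); last exact: smooth_form2.
by congr (anchor _ _); apply/funext => y; rewrite (Om_skew sOm).
Qed.

Section Frame.
Variables (t : triv A) (x : M) (phi : M -> R).
Hypotheses (hphi : cutoff_at (triv_dom t) x phi).

Let cphi : cutoff (triv_dom t) phi. Proof. by case: hphi. Qed.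
Let px : phi x = 1. Proof. by case: hphi. Qed.
Let e := cut_frame t phi.
Let f := cut_dual Om t phi.
Let psi y := phi y * phi y.

(** The components of a section v in the frame e and in its dual frame f. *)
Let comp_e v i y := phi y * coframe t i y (v y).
Let comp_f v i y := flat Om y (v y) (e i y) : R.

Let se i : smooth_section (e i). Proof. exact: smooth_cut_frame. Qed.
Let sf i : smooth_section (f i). Proof. exact: smooth_cut_dual. Qed.
Let s_psi : smooth psi. Proof. exact: (smooth_cutoff_sqr hphi). Qed.
Let psix : psi x = 1. Proof. by rewrite /psi px mulr1. Qed.

Let smooth_comp_e v i : smooth_section v -> smooth (comp_e v i).
Proof. by move=> sv; exact: smooth_coframe. Qed.

Let smooth_comp_f v i : smooth_section v -> smooth (comp_f v i).
Proof.
move=> sv; rewrite /comp_f (_ : (fun y => _) = fun y => - Om y [:: v y; e i y]).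
  by apply: smoothN; exact: smooth_form2.
by apply/funext => y; rewrite flatE.
Qed.

Let flat_f v i y : flat Om y (v y) (f i y) = - comp_e v i y.
Proof.
rewrite /f /cut_dual covecZ flatE// Om_skew// opprK /comp_e.
by rewrite (sharp_flatE sOm ndOm (coframe t i y)) mulrN opprK.
Qed.

Let expand_e v y : psi y *: v y = \sum_i comp_e v i y *: e i y.
Proof. exact: section_cutoff. Qed.

Let expand_f v y : psi y *: v y = \sum_i comp_f v i y *: f i y.
Proof.
have [ty|nty] := pselect (triv_dom t y); last first.
  rewrite /psi (cutoff_out cphi nty) mul0r scale0r big1// => i _.
  by rewrite /f /cut_dual (cutoff_out cphi nty) scale0r scaler0.
rewrite -{1}(flatK sOm ndOm (v y)) {1}(coframe_expand (flat Om y (v y)) ty).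
rewrite /sharp linear_sum scaler_sumr; apply: eq_bigr => i _.
by rewrite linearZ /comp_f /e /f /cut_frame /cut_dual covecZ !scalerA /psi;
  congr (_ *: _); ring.
Qed.

Let comp_e_f v w y : \sum_i comp_e w i y * comp_f v i y = -
  (psi y * Om y [:: v y; w y]).
Proof.
rewrite -mulrN -flatE// -covecZ expand_e covec_sum.
by apply: eq_bigr => i _; rewrite covecZ.
Qed.

Let tD a := anchor_tangent (a x).

(** The derivative of comp_e_f at x, where psi = 1 and d psi = 0. *)
Let rho_comp_e_f a v w : smooth_section a -> smooth_section v -> smooth_section w ->
  \sum_i (rho a (comp_e w i) x * comp_f v i x + comp_e w i x * rho a (comp_f v i) x) =
  - rho a (fun y => Om y [:: v y; w y]) x.
Proof.
move=> sa sv sw.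
rewrite /rho -(tangent_cutoff hphi (tD a)); last exact: smooth_form2.
rewrite -(tangentN (tD a)); last by apply: smoothM => //; exact: smooth_form2.
rewrite (_ : (fun y => _) = fun y => \sum_i comp_e w i y * comp_f v i y); last first.
  by apply/funext => y; rewrite comp_e_f.
rewrite (tangent_sum (tD a)) => [|i]; last by apply: smoothM;
  [exact: smooth_comp_e|exact: smooth_comp_f].
by apply: eq_bigr => i _; rewrite (tangentM (tD a))//;
  [exact: smooth_comp_e|exact: smooth_comp_f].
Qed.

Let Pi_sum : (fun y s => psi y * contra_Pi Om s) =
  (fun y s => \sum_i 2^-1 * ext_wedge (mv_of_section (e i) y) (mv_of_section (f i) y)
    s).
Proof. exact: (Pi_decomposition sOm ndOm cphi). Qed.

Let sPi := smooth_Pi sOm ndOm.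
Let dPi := (@mv_degree_Pi _ _ _ _ A Om).

Let rho_psi a : rho a psi x = 0.
Proof. exact: (tangent_cutoff_sqr hphi (tD a)). Qed.

Let smvs a (sa : smooth_section a) : smooth_mvector (mv_of_section a) :=
  smooth_mv_section sa.
Let dmvs a : mv_degree 1 (mv_of_section a) := @mv_degree_section _ _ _ _ A a.
Let swd i : smooth_mvector
  (fun y => ext_wedge (mv_of_section (e i) y) (mv_of_section (f i) y)).
Proof. exact: smooth_mv_wedge. Qed.

Lemma schouten_section_Pi_frame a s : smooth_section a ->
  B (mv_of_section a) (contra_Pi Om) x s =
  \sum_i 2^-1 * (ext_wedge (mv_of_section (bracket a (e i)) x) (mv_of_section (f i) x) s
               + ext_wedge (mv_of_section (e i) x) (mv_of_section (bracket a (f i)) x)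
                 s).
Proof.
move=> sa; have sma := smvs sa.
rewrite -(schouten_cutoff hB s sma (@dmvs a) sPi s_psi psix) => [|l]; last first.
  by rewrite schouten_section_fun// /mv_of_fun rho_psi; case: l.
rewrite Pi_sum (schouten_sumr hB)//; apply: eq_bigr => i _; congr (_ * _).
rewrite (schouten_wedge hB sma (@dmvs a) (smvs (se i)) (@dmvs _) (smvs (sf i))).
by rewrite !schouten_section_section// muln1 sqrrN expr1n mul1r.
Qed.

(** [psi, Pi] is, up to sign, the contraction of Pi with d psi, and d psi = 0 at x. *)
Let schouten_fun_Pi l : B (mv_of_fun A psi) (contra_Pi Om) x l = 0.
Proof.
have smp := smooth_mv_fun (A := A) s_psi.
have dmp := @mv_degree_fun _ _ _ _ A psi.
rewrite -(schouten_cutoff hB l smp dmp sPi s_psi psix); last by move=> ?;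
  exact: schouten_fun.
rewrite Pi_sum (schouten_sumr hB)// big1// => i _.
rewrite (schouten_wedge hB smp dmp (smvs (se i)) (@dmvs _) (smvs (sf i))).
rewrite !schouten_fun_section// wedge0l ?wedge0r ?mulr0 ?addr0 ?mulr0// => m;
  by rewrite /mv_of_fun rho_psi; case: m.
Qed.

Lemma schouten_Pi_Pi_frame s :
  B (contra_Pi Om) (contra_Pi Om) x s =
  \sum_i 2^-1 * (ext_wedge (B (mv_of_section (e i)) (contra_Pi Om) x)
    (mv_of_section (f i) x) s
               - ext_wedge (mv_of_section (e i) x)
                 (B (mv_of_section (f i)) (contra_Pi Om) x) s).
Proof.
have sym a : smooth_section a -> B (contra_Pi Om) (mv_of_section a) x =
  B (mv_of_section a) (contra_Pi Om) x.
  move=> sa; apply/funext => l.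
  by rewrite (schouten_sym hB sPi dPi (smvs sa) (@dmvs a)) muln1 sqrrN expr1n mul1r.
rewrite -(schouten_cutoff hB s sPi dPi sPi s_psi psix) => [|l]; last first.
  rewrite (schouten_sym hB sPi dPi (smooth_mv_fun (A := A) s_psi)
    (@mv_degree_fun _ _ _ _ A psi)).
  by rewrite schouten_fun_Pi mulr0.
rewrite Pi_sum (schouten_sumr hB)//; apply: eq_bigr => i _; congr (_ * _).
rewrite (schouten_wedge hB sPi dPi (smvs (se i)) (@dmvs _) (smvs (sf i))).
by rewrite !sym// -signr_odd /= expr1 mulN1r.
Qed.

Lemma schouten_section_Pi_degree_frame a : smooth_section a ->
  homogeneous 2 (B (mv_of_section a) (contra_Pi Om) x).
Proof.
move=> sa s hs; rewrite schouten_section_Pi_frame// big1// => i _.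
by rewrite !(homogeneous_wedge (@dmvs _ x) (@dmvs _ x))// addr0 mulr0.
Qed.

Lemma schouten_Pi_Pi_degree_frame : homogeneous 3 (B (contra_Pi Om) (contra_Pi Om) x).
Proof.
move=> s hs; rewrite schouten_Pi_Pi_frame big1// => i _.
rewrite (homogeneous_wedge (schouten_section_Pi_degree_frame (se i)) (@dmvs _ x))//.
by rewrite (homogeneous_wedge (@dmvs _ x) (schouten_section_Pi_degree_frame (sf i)))//
  subrr mulr0.
Qed.

(** The terms with f paired against flat w contain the components of w along e, and
    those with e paired against flat v the components of v along f, so both sums
    assemble into [a, w] and [a, v]; the derivatives of components that are left
    over add up to the derivative of Omega(v, w). *)
Lemma schouten_section_Pi_flat_frame a v w :
  smooth_section a -> smooth_section v -> smooth_section w ->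
  B (mv_of_section a) (contra_Pi Om) x [:: flat Om x (v x); flat Om x (w x)] = -
    lie_2form a v w x.
Proof.
move=> sa sv sw; rewrite schouten_section_Pi_frame//.
(* The contribution of the products in one order; the other order exchanges v and
   w. *)
pose X v w := Om x [:: v x; bracket a w x] - Om x [:: w x; bracket a v x] -
  rho a (fun y => Om y [:: v y; w y]) x.
have XE v' w' : smooth_section v' -> smooth_section w' ->
  \sum_i (flat Om x (v' x) (bracket a (e i) x) * flat Om x (w' x) (f i x)
   + flat Om x (v' x) (e i x) * flat Om x (w' x) (bracket a (f i) x)) = X v' w'.
  move=> sv' sw'.
  have E1 : - Om x [:: v' x; bracket a w' x] =
     \sum_i (comp_e w' i x * flat Om x (v' x) (bracket a (e i) x) +
       rho a (comp_e w' i) x * comp_f v' i x).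
    rewrite -flatE// (bracket_expand hphi sa sw' (fun i => smooth_comp_e i sw') se
      (expand_e w')) covec_sum.
    by apply: eq_bigr => i _; rewrite covecD; congr (_ + _); exact: covecZ.
  have E2 : - Om x [:: w' x; bracket a v' x] =
     \sum_i (comp_f v' i x * flat Om x (w' x) (bracket a (f i) x) -
       rho a (comp_f v' i) x * comp_e w' i x).
    rewrite -flatE// (bracket_expand hphi sa sv' (fun i => smooth_comp_f i sv') sf
      (expand_f v')) covec_sum.
    apply: eq_bigr => i _; rewrite covecD; congr (_ + _); first exact: covecZ.
    by rewrite covecZ flat_f mulrN.
  have E3 := rho_comp_e_f sa sv' sw'.
  rewrite /X -[X in X - _ - _]opprK E1 E2 -E3 -sumrN -!big_split /=.
  by apply: eq_bigr => i _; rewrite flat_f /comp_f; ring.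
have -> : - lie_2form a v w x = 2^-1 * (X v w - X w v).
  by rewrite /X (rho_skew a x sw sv) /lie_2form [Om x [:: bracket a v x; _]]Om_skew//;
    field.
rewrite -!XE// -sumrB mulr_sumr; apply: eq_bigr => i _; congr (_ * _).
by rewrite /mv_of_section !wedge_deg1 /=; ring.
Qed.

(** L_u Omega is a first order operator in u: if u = sum_i g_i h_i, then
    L_u Omega = sum_i (g_i L_(h_i) Omega + d g_i /\ i_(h_i) Omega). *)
Lemma lie_2form_expand (g : 'I_r -> M -> R) (h : 'I_r -> section A) u v w :
  smooth_section u -> smooth_section v -> smooth_section w ->
  (forall i, smooth (g i)) -> (forall i, smooth_section (h i)) ->
  (forall y, psi y *: u y = \sum_i g i y *: h i y) ->
  \sum_i g i x * lie_2form (h i) v w x = lie_2form u v w x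
   - \sum_i (rho v (g i) x * Om x [:: h i x; w x] +
     rho w (g i) x * Om x [:: v x; h i x]).
Proof.
move=> su sv sw sg sh E.
have Ex : u x = \sum_i g i x *: h i x by rewrite -E psix scale1r.
have br s : smooth_section s -> bracket u s x =
    \sum_i (g i x *: bracket (h i) s x - rho s (g i) x *: h i x).
  move=> ss; rewrite bracket_skew// (bracket_expand hphi ss su sg sh E) -sumrN.
  by apply: eq_bigr => i _; rewrite [bracket (h i) s x]bracket_skew// scalerN opprD.
have OL (c : 'I_r -> R) (p q : 'I_r -> A x) (d : 'I_r -> R) z :
    Om x [:: \sum_i (c i *: p i - d i *: q i); z] =
    \sum_i (c i * Om x [:: p i; z] - d i * Om x [:: q i; z]).
  have OF p' : Om x [:: p'; z] = flat Om x z p' by rewrite flatE// -Om_skew.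
  rewrite OF covec_sum; apply: eq_bigr => i _.
  by rewrite !OF covecD covecN !covecZ.
rewrite /lie_2form (br v)// (br w)// OL [Om x [:: v x; \sum_i _]]Om_skew// OL.
rewrite /rho Ex anchor_sum -!sumrN -!big_split /=; apply: eq_bigr => i _.
by rewrite [Om x [:: v x; h i x]]Om_skew//
  [Om x [:: v x; bracket (h i) w x]]Om_skew//; ring.
Qed.

(** In [Pi, Pi], the Leibniz rule yields L_(e_i) Omega and L_(f_i) Omega with the
    components of u, v, w as coefficients (K).  By lie_2form_expand these sums are
    2 L_u Omega and its cyclic permutations, up to derivatives of components (E).
    In the cyclic sum, the latter combine in pairs into derivatives of Omega(u, v),
    Omega(v, w), Omega(w, u) (EE). *)
Lemma schouten_Pi_Pi_flat_frame u v w :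
  smooth_section u -> smooth_section v -> smooth_section w ->
  B (contra_Pi Om) (contra_Pi Om) x [:: flat Om x (u x); flat Om x (v x);
    flat Om x (w x)]
  = 2 * d_2form u v w x.
Proof.
move=> su sv sw.
pose E a u w := \sum_i (rho a (comp_f u i) x * comp_e w i x -
  rho a (comp_e u i) x * comp_f w i x).
pose K u v w := \sum_i (comp_e u i x * lie_2form (e i) v w x +
  comp_f u i x * lie_2form (f i) v w x).
have KE u' v' w' : smooth_section u' -> smooth_section v' -> smooth_section w' ->
  K u' v' w' = 2 * lie_2form u' v' w' x + E v' u' w' - E w' u' v'.
  move=> su' sv' sw'; rewrite /K big_split /=.
  rewrite (lie_2form_expand su' sv' sw' (fun i => smooth_comp_e i su') se
    (expand_e u')).
  rewrite (lie_2form_expand su' sv' sw' (fun i => smooth_comp_f i su') sf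
    (expand_f u')).
  rewrite addrACA -opprD -big_split /= -[RHS]addrA /E -sumrB mulr_natl mulr2n.
  congr (_ + _); rewrite -sumrN; apply: eq_bigr => i _.
  have ve z : Om x [:: z x; e i x] = - comp_f z i x by rewrite /comp_f flatE// opprK.
  have ev z : Om x [:: e i x; z x] = comp_f z i x by rewrite Om_skew// ve opprK.
  have vf z : Om x [:: z x; f i x] = comp_e z i x by apply: oppr_inj;
    rewrite -flatE// flat_f.
  have fv z : Om x [:: f i x; z x] = - comp_e z i x by rewrite Om_skew// vf.
  by rewrite !ve !ev !vf !fv; ring.
have EE a u' w' : smooth_section a -> smooth_section u' -> smooth_section w' ->
  E a u' w' - E a w' u' = - (2 * rho a (fun y => Om y [:: u' y; w' y]) x).
  move=> sa su' sw'; rewrite mulr_natl mulr2n opprD {2}(rho_skew _ _ su' sw')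
    -!rho_comp_e_f//.
  rewrite -sumrN /E -!sumrB -big_split /=; apply: eq_bigr => i _; ring.
have -> : B (contra_Pi Om) (contra_Pi Om) x [:: flat Om x (u x); flat Om x (v x);
  flat Om x (w x)]
  = 2^-1 * (K u v w - K v u w + K w u v).
  rewrite schouten_Pi_Pi_frame /K -sumrB -big_split /= mulr_sumr;
    apply: eq_bigr => i _; congr (_ * _).
  rewrite (wedge_21 _ _ _ (schouten_section_Pi_degree_frame (se i)) (@dmvs _ x)).
  rewrite (wedge_12 _ _ _ (@dmvs _ x) (schouten_section_Pi_degree_frame (sf i))).
  by rewrite !schouten_section_Pi_flat_frame// /mv_of_section /= !flat_f
    -!/(comp_f _ _ _); ring.
rewrite !KE//.
have e1 := EE v u w sv su sw; have e2 := EE w v u sw sv su;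
  have e3 := EE u w v su sw sv.
rewrite (rho_skew w x sv su) in e2; rewrite (rho_skew u x sw sv) in e3.
have OmN p q : Om x [:: - p; q] = - Om x [:: p; q].
  have OF p' : Om x [:: p'; q] = flat Om x q p' by rewrite flatE// -Om_skew.
  by rewrite !OF covecN.
have l1 : lie_2form u v w x = rho u (fun y => Om y [:: v y; w y]) x
    - Om x [:: bracket u v x; w x] + Om x [:: bracket u w x; v x].
  by rewrite /lie_2form [Om x [:: v x; _]]Om_skew// opprK.
have l2 : lie_2form v u w x = rho v (fun y => Om y [:: u y; w y]) x
    + Om x [:: bracket u v x; w x] + Om x [:: bracket v w x; u x].
  by rewrite /lie_2form [Om x [:: u x; _]]Om_skew// (bracket_skew sv su) OmN !opprK.
have l3 : lie_2form w u v x = rho w (fun y => Om y [:: u y; v y]) x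
    + Om x [:: bracket u w x; v x] - Om x [:: bracket v w x; u x].
  by rewrite /lie_2form [Om x [:: u x; _]]Om_skew// (bracket_skew sw su)
    (bracket_skew sw sv) !OmN !opprK.
rewrite l1 l2 l3 /d_2form; lra.
Qed.

End Frame.
End BivectorBrackets.

(** * Locally conformally symplectic and Jacobi structures *)

Section Equivalence.
Context {R : realType} {n : nat} {M : manifold R n} {r : nat}.
Variables (A : skew_algebroid M r) (Om th : form_field A).
Arguments Om : clear implicits.
Arguments th : clear implicits.
Hypotheses (sOm : smooth_form Om) (Om2 : form_degree 2 Om) (ndOm : nondeg_form Om).
Hypotheses (sth : smooth_form th) (th1 : form_degree 1 th).
Variables (B : mv_field A -> mv_field A -> mv_field A) (hB : is_schouten B).
Arguments B : clear implicits.
Implicit Types (a b u v w : section A) (f g : M -> R) (x y : M).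

Lemma size_omit (T : Type) i (s : seq T) : (i < size s)%N -> size (omit i s) =
    (size s).-1.
Proof. by move=> hi; rewrite size_cat size_takel 1?ltnW// size_drop; lia. Qed.

(** In degrees other than k + 1 every term evaluates eta on a list of the wrong
    size. *)
Lemma dform_degree k (eta : form_field A) x :
  form_degree k eta -> homogeneous k.+1 (dform eta x).
Proof.
move=> de s ks; rewrite /dform /form_of_tensor !size_map.
have e0 l : size l != k -> eval_form eta l = fun=> 0.
  by move=> lk; apply/funext => y; rewrite /eval_form de// size_map.
set S := map _ s; have hS : size S = size s by rewrite size_map.
rewrite !big1 ?addr0// => j _; have hj := ltn_ord j.
  rewrite big1// => i _; have hi := ltn_ord i; rewrite e0 ?mulr0//=.
  have sj : size (omit j S) = (size s).-1 by rewrite size_omit hS.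
  rewrite size_omit sj; last by lia.
  by move/eqP: ks => ks; apply/eqP; lia.
rewrite e0; first by rewrite /rho (tangent0 (anchor_tangent _)) mulr0.
by rewrite size_omit hS//; move/eqP: ks => ks; apply/eqP; lia.
Qed.

Lemma dform_1form (eta : form_field A) x (u v : A x) : dform eta x [:: u; v] =
  rho (ext u) (fun y => eta y [:: ext v y]) x - rho (ext v)
    (fun y => eta y [:: ext u y]) x
  - eta x [:: bracket (ext u) (ext v) x].
Proof.
rewrite /dform /form_of_tensor /= !big_ord_recl !big_ord0 /= /eval_form /= /bump /=.
by rewrite expr0 expr1 !mulN1r mul1r !addr0 !add0r.
Qed.

Lemma dform_2form x (u v w : A x) : dform Om x [:: u; v; w] =
    d_2form Om (ext u) (ext v) (ext w) x.
Proof.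
rewrite /dform /form_of_tensor /= !big_ord_recl !big_ord0 /= /eval_form /= /bump /=
  /d_2form.
rewrite !(exprS, expr0, add0n, addn0) /=; ring.
Qed.

Let xi := contra_xi Om th.

Lemma Om_xi x (v : A x) : Om x [:: xi x; v] = - th x [:: v].
Proof.
have := sharp_flatE sOm ndOm (covector th x) v.
rewrite /covector linfunE; first by move=> ->; rewrite opprK.
by move=> k a b; have [m _] := sth.1 x; exact: (m [::] [::]).
Qed.

Lemma smooth_xi : smooth_section xi.
Proof.
move=> t i; apply: (smooth_on_sharp sOm ndOm (al := covector th)) => j.
rewrite (_ : (fun x => _) = fun x => th x [:: frame t j x]);
  first exact: (sth.2 t [:: j]).
apply/funext => x; rewrite /covector linfunE// => k a b.
by have [m _] := sth.1 x; exact: (m [::] [::]).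
Qed.

(** (theta /\ Omega)(u, v, w). *)
Definition theta_Omega u v w x := th x [:: u x] * Om x [:: v x; w x]
  - th x [:: v x] * Om x [:: u x; w x] + th x [:: w x] * Om x [:: u x; v x].

Lemma wedge_theta_Omega u v w x : ext_wedge (th x) (Om x) [:: u x; v x; w x] =
    theta_Omega u v w x.
Proof. exact: wedge_12. Qed.

Lemma wedge_xi_Pi u v w x :
  ext_wedge (mv_of_section xi x) (@contra_Pi _ _ _ _ A Om x)
    [:: flat Om x (u x); flat Om x (v x); flat Om x (w x)] = - theta_Omega u v w x.
Proof.
rewrite wedge_12; [|exact: mv_degree_section|exact: mv_degree_Pi].
rewrite !contra_Pi_flat// /mv_of_section /= !flatE//.
by rewrite ![Om x [:: _ ; xi x]]Om_skew// !opprK !Om_xi /theta_Omega; ring.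
Qed.

(** Every covector at x is flat of a smooth section, so the identities for sections
    determine multivectors at x. *)
Lemma flat_ext x (al : cofiber A x) : al = flat Om x (ext (sharp Om al) x).
Proof. by rewrite (extP _).2 sharpK. Qed.

(** The left-hand side depends only on the values of u, v and w at x, hence so does
    d_2form: its tensoriality need not be checked separately. *)
Lemma schouten_Pi_Pi_flat u v w x : smooth_section u -> smooth_section v ->
    smooth_section w ->
  B (contra_Pi Om) (contra_Pi Om) x [:: flat Om x (u x); flat Om x (v x);
    flat Om x (w x)]
  = 2 * d_2form Om u v w x.
Proof.
have [t tx] := triv_cover A x; have [phi hphi] := cutoff_at_exists tx.
exact: schouten_Pi_Pi_flat_frame hphi _ _ _.
Qed.

Lemma schouten_Pi_Pi_degree x : homogeneous 3 (B (contra_Pi Om) (contra_Pi Om) x).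
Proof.
have [t tx] := triv_cover A x; have [phi hphi] := cutoff_at_exists tx.
exact: schouten_Pi_Pi_degree_frame hphi.
Qed.

Lemma schouten_section_Pi_flat a v w x : smooth_section a -> smooth_section v ->
    smooth_section w ->
  B (mv_of_section a) (contra_Pi Om) x [:: flat Om x (v x); flat Om x (w x)] = -
    lie_2form Om a v w x.
Proof.
have [t tx] := triv_cover A x; have [phi hphi] := cutoff_at_exists tx.
exact: schouten_section_Pi_flat_frame hphi _ _ _.
Qed.

Lemma schouten_section_Pi_degree a x : smooth_section a ->
  homogeneous 2 (B (mv_of_section a) (contra_Pi Om) x).
Proof.
have [t tx] := triv_cover A x; have [phi hphi] := cutoff_at_exists tx.
exact: schouten_section_Pi_degree_frame hphi _.
Qed.

Definition Pi_equation := forall x s,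
  B (contra_Pi Om) (contra_Pi Om) x s = 2 * ext_wedge (mv_of_section xi x)
    (@contra_Pi _ _ _ _ A Om x) s.

Lemma Pi_equationP : Pi_equation <->
  forall x s, dform Om x s + ext_wedge (th x) (Om x) s = 0.
Proof.
split=> E x s.
  have [s3|s3] := eqVneq (size s) 3; last first.
    by rewrite (dform_degree Om2)// (homogeneous_wedge (@th1 x) (@Om2 x))// addr0.
  case: s s3 => [|u [|v [|w []]]]// _; rewrite dform_2form.
  have [[[su eu] [sv ev]] [sw ew]] := (extP u, extP v, extP w).
  have := wedge_theta_Omega (ext u) (ext v) (ext w) x; rewrite eu ev ew => ->.
  have := E x [:: flat Om x (ext u x); flat Om x (ext v x); flat Om x (ext w x)].
  by rewrite schouten_Pi_Pi_flat// wedge_xi_Pi; lra.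
have [s3|s3] := eqVneq (size s) 3; last first.
  rewrite schouten_Pi_Pi_degree//
    (homogeneous_wedge (@mv_degree_section _ _ _ _ A xi x)
      (@mv_degree_Pi _ _ _ _ A Om x))//.
  by rewrite mulr0.
case: s s3 => [|u [|v [|w []]]]// _.
have se z : smooth_section (@ext _ _ _ _ A x z) by case: (extP z).
rewrite [u]flat_ext [v]flat_ext [w]flat_ext schouten_Pi_Pi_flat// wedge_xi_Pi.
set u' := ext _; set v' := ext _; set w' := ext _.
have := E x [:: u' x; v' x; w' x].
by rewrite dform_2form wedge_theta_Omega /u' /v' /w' !(extP _).2; lra.
Qed.

Lemma Pi_equation_d_2form u v w x : Pi_equation ->
  smooth_section u -> smooth_section v -> smooth_section w -> d_2form Om u v w x = -
    theta_Omega u v w x.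
Proof.
move=> E su sv sw.
have := E x [:: flat Om x (u x); flat Om x (v x); flat Om x (w x)].
by rewrite schouten_Pi_Pi_flat// wedge_xi_Pi; lra.
Qed.

(** This is L_xi Omega = - d theta.  It uses d Omega + theta /\ Omega = 0 with
    first argument xi, where theta /\ Omega vanishes because i_xi Omega = - theta
    and theta(xi) = 0. *)
Lemma schouten_xi_Pi v w x : Pi_equation -> smooth_section v -> smooth_section w ->
  B (mv_of_section xi) (contra_Pi Om) x [:: flat Om x (v x); flat Om x (w x)] =
  rho v (fun y => th y [:: w y]) x - rho w (fun y => th y [:: v y]) x
  - th x [:: bracket v w x].
Proof.
move=> E sv sw; rewrite schouten_section_Pi_flat//; last exact: smooth_xi.
have := Pi_equation_d_2form x E smooth_xi sv sw.
have Omxi z z' : smooth_section z' ->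
    rho z (fun y => Om y [:: xi y; z' y]) x = - rho z (fun y => th y [:: z' y]) x.
  move=> sz'; rewrite /rho -(tangentN (anchor_tangent _)); last exact: smooth_form1.
  by congr (anchor _ _); apply/funext => y; rewrite Om_xi.
have thxi : th x [:: xi x] = 0 by apply: oppr_inj; rewrite -Om_xi Om_diag// oppr0.
rewrite /d_2form /theta_Omega /lie_2form !Omxi// thxi !Om_xi.
rewrite [Om x [:: bracket v w x; _]]Om_skew// Om_xi
  [Om x [:: v x; bracket _ _ _]]Om_skew//.
by lra.
Qed.

(** [xi, Pi] is the only smooth multivector field that is a Lie derivative of Pi
    along xi. *)
Lemma is_lie_xi_Pi : is_lie_mv xi (contra_Pi Om) (fun _ _ => 0) <->
  forall x s, B (mv_of_section xi) (contra_Pi Om) x s = 0.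
Proof.
have sPi := smooth_Pi sOm ndOm; have sx := smooth_xi.
split=> [L|E].
  suff -> : B (mv_of_section xi) (contra_Pi Om) = fun _ _ => 0 by [].
  apply: mv_eq_pairing => [||eta seta x].
  - by apply: schouten_smooth => //; exact: smooth_mv_section.
  - exact: smooth_mv0.
  - by rewrite (schouten_section hB sx sPi seta) L.
move=> eta seta x; rewrite -(schouten_section hB sx sPi seta).
by congr (pairing _ _ _); apply: mv_ext => y s; rewrite E.
Qed.

Lemma dtheta_xi_Pi : Pi_equation ->
  (forall x s, B (mv_of_section xi) (contra_Pi Om) x s = 0) <->
    (forall x s, dform th x s = 0).
Proof.
move=> E; split=> H x s.
  have [s2|s2] := eqVneq (size s) 2; last by rewrite (dform_degree th1).
  case: s s2 => [|v [|w []]]// _; rewrite dform_1form.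
  have [[sv ev] [sw ew]] := (extP v, extP w).
  by rewrite -(schouten_xi_Pi x E)// H.
have [s2|s2] := eqVneq (size s) 2; last by rewrite
  (schouten_section_Pi_degree smooth_xi).
case: s s2 => [|v [|w []]]// _.
have se z : smooth_section (@ext _ _ _ _ A x z) by case: (extP z).
rewrite [v]flat_ext [w]flat_ext schouten_xi_Pi//.
by rewrite -dform_1form.
Qed.

Lemma lcs_iff_jacobi : is_lcs Om th <-> is_jacobi B (contra_Pi Om) xi.
Proof.
split=> [[_ _ dth dOm]|[_ _ E L]].
  have E : Pi_equation by apply/Pi_equationP.
  split=> //; [|exact: smooth_xi|].
    by split; [exact: smooth_Pi|exact: mv_degree_Pi].
  by apply/is_lie_xi_Pi/(dtheta_xi_Pi E).
have {}E : Pi_equation by [].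
split=> //; last exact/Pi_equationP.
by apply/(dtheta_xi_Pi E)/is_lie_xi_Pi.
Qed.
End Equivalence.

Theorem theorem3p10 (R : realType) (n r : nat) (M : manifold R n)
    (A : skew_algebroid M r)
    (B : mv_field A -> mv_field A -> mv_field A) (hB : is_schouten B)
    (Omega : form_field A) (hOmega : smooth_form Omega)
    (hOmega2 : form_degree 2 Omega) (hOmega_nd : nondeg_form Omega)
    (theta : form_field A) (htheta : smooth_form theta)
    (htheta1 : form_degree 1 theta) :
  is_lcs Omega theta <->
  is_jacobi B (contra_Pi Omega) (contra_xi Omega theta).
Proof. exact: lcs_iff_jacobi. Qed.
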